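(* Let $M$ be a smooth manifold, and consider a system of left homotopy operators $J_L$ on $M$, with associated operators $\mathcal E_L^{p,q}\varpi=\mathrm d^L(J_L^{p,q}\varpi)$ and $\mathcal A_L^{p,q}\varpi=J_L^{p+1,q}(\mathrm d^L\varpi)$ on $\Omega^{p,q}_{\Delta_M}(M\mid M)$. (a) For any $(p,q)\in\mathbb N_0\times\mathbb N_0$, $$\mathrm d^L\,\mathrm{Im}\,\mathcal A_L^{p,q}=\mathrm{Im}\,\mathcal E_L^{p+1,q}.$$ (b) For each $(p,q)\in\mathbb N_0\times\mathbb N_0$, there is the vector space decomposition $$\Omega^{p+1,q}_{\Delta_M}(M\mid M)=\mathrm d^L\,\mathrm{Im}\,\mathcal A_L^{p,q}\oplus\mathrm{Im}\,\mathcal A_L^{p+1,q}.$$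
   Context: $\mathbb N_0=\{0,1,2,\dots\}$, $\mathbb N=\mathbb N_0\setminus\{0\}$. $M$ is a finite-dimensional, paracompact, connected smooth manifold; $\pi_L,\pi_R\colon M\times M\to M$ are the two projections, $\iota(m)=(m,m)$ the diagonal embedding with image $\Delta_M$; for $X\in\mathfrak X(M)$, $X^L=(X,0)\in\mathfrak X(M\times M)$. A $(p,q)$-bi-form is a smooth section of $\bigwedge^p\pi_L^*T^*M\otimes\bigwedge^q\pi_R^*T^*M\to M\times M$. $\Omega^{p,q}_{\Delta_M}(M\mid M)$ is the real vector space of local $(p,q)$-bi-forms, i.e. those defined on some open neighbourhood of $\Delta_M$; two of them are identified, and equalities are understood, after restriction to a smaller open neighbourhood of $\Delta_M$. It is $0$ if $p<0$ or $q<0$. For vector fields on $M$, $\varpi(X_1,\dots,X_p\mid Y_1,\dots,Y_q)(m,n)=\varpi_{(m,n)}((X_1)_m,\dots\mid(Y_1)_n,\dots)$. The diagonal restriction is $\varpi_{\restriction\Delta_M}(Z_1,\dots,Z_{p+q})=\iota^*(\varpi(Z_1,\dots,Z_p\mid Z_{p+1},\dots,Z_{p+q}))$. For $\alpha\in\Omega^p(M),\beta\in\Omega^q(M)$, $\alpha\boxtimes\beta=\pi_L^*\alpha\otimes\pi_R^*\beta$. The left exterior derivative $\mathrm d^L\colon\Omega^{p,q}_{\Delta_M}(M\mid M)\to\Omega^{p+1,q}_{\Delta_M}(M\mid M)$ is $$(\mathrm d^L\varpi)(X_0,\dots,X_p\mid Y_1,\dots,Y_q)=\sum_i(-1)^i\mathcal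 L_{X_i^L}\big(\varpi(X_0,\dots,\check X_i,\dots,X_p\mid Y_1,\dots,Y_q)\big)+\sum_{a<b}(-1)^{a+b}\varpi([X_a,X_b],X_0,\dots,\check X_a,\dots,\check X_b,\dots,X_p\mid Y_1,\dots,Y_q)$$ (checked arguments omitted); it satisfies $\mathrm d^L\circ\mathrm d^L=0$. A system of left homotopy operators is a family of $\mathbb R$-linear operators $J_L^{p,q}\colon\Omega^{p,q}_{\Delta_M}(M\mid M)\to\Omega^{p-1,q}_{\Delta_M}(M\mid M)$, $(p,q)\in\mathbb N_0\times\mathbb N_0$, such that $J_L^{p-1,q}\circ J_L^{p,q}=0$ and for each $\varpi\in\Omega^{p,q}_{\Delta_M}(M\mid M)$, on some open neighbourhood of $\Delta_M$ contained in the domain of $\varpi$, $$\mathrm d^LJ_L^{p,q}\varpi+J_L^{p+1,q}\mathrm d^L\varpi=\varpi\ \text{ if } p\ge1,\qquad J_L^{1,q}\mathrm d^L\varpi=\varpi-1\boxtimes\varpi_{\restriction\Delta_M}\ \text{ if } p=0.$$ *)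

(* Defs.v *)
From HB Require Import structures.
From mathcomp Require Import all_boot all_order all_algebra.
From mathcomp Require Import generic_quotient ring_quotient.
From mathcomp Require Import all_classical all_reals all_analysis.

Set Implicit Arguments.
Unset Strict Implicit.
Unset Printing Implicit Defensive.

Import Order.TTheory GRing.Theory Num.Theory.
Import numFieldNormedType.Exports.

Local Open Scope classical_set_scope.
Local Open Scope ring_scope.
Local Open Scope quotient_scope.

Section Smooth.
Context {R : realType} {V W : normedModType R}.
Implicit Types (A : set V) (f g : V -> W).

Fixpoint ndiff (n : nat) A f : Prop :=
  if n is n'.+1 then
    (forall x, A x -> differentiable f x) /\
    (forall v, ndiff n' A (fun x => 'D_v f x))
  else True.

(* Used only for A open and V finite-dimensional: f is C^oo on A. *)
Definition smooth_on A f : Prop := forall n, ndiff n A f.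

Lemma near_ext A f g : open A -> (forall x, A x -> f x = g x) ->
  forall x, A x -> {near x, f =1 g}.
Proof.
move=> oA fg x Ax; have := open_nbhs_nbhs (conj oA Ax).
by apply: filterS => y Ay; exact: fg.
Qed.

Lemma near_differentiable f g x :
  {near x, f =1 g} -> differentiable f x -> differentiable g x.
Proof.
move=> fg df; have dfc : continuous ('d f x) by exact: diff_continuous.
have gE : g \o shift x = cst (g x) + 'd f x +o_ 0 id.
  apply/eqaddoP => e e0.
  have /eqaddoP/(_ e e0) := diff_locally df.
  have : \forall h \near (0 : V), f (h + x) = g (h + x).
    rewrite (near_shift x) /=; apply: filterS fg => y.
    by rewrite /= sub0r subrK.
  apply: filterS2 => h /= fgh.
  by rewrite /= ![in X in X -> _]fctE ![in X in _ -> X]fctE /= fgh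
             (nbhs_singleton fg).
by apply/diff_locallyP; rewrite (diff_unique dfc gE).
Qed.

Lemma ndiff_ext n A f g : open A -> (forall x, A x -> f x = g x) ->
  ndiff n A f -> ndiff n A g.
Proof.
move=> oA; elim: n f g => //= n IH f g fg [df Df]; split=> [x Ax|v].
  exact: near_differentiable (near_ext oA fg Ax) (df _ Ax).
apply: IH (Df v) => x Ax; apply: near_eq_derive; exact: near_ext oA fg x Ax.
Qed.

Lemma ndiff_sub n A B f : A `<=` B -> ndiff n B f -> ndiff n A f.
Proof.
move=> AB; elim: n f => //= n IH f [df Df]; split=> [x /AB /df //|v].
exact/IH/Df.
Qed.

Lemma ndiff0 n A : ndiff n A (fun=> 0).
Proof.
elim: n => //= n IH; split=> [x _|v]; first exact: differentiable_cst.
by under eq_fun do rewrite derive_cst.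
Qed.

Lemma ndiff_lin n A a f g : open A -> ndiff n A f -> ndiff n A g ->
  ndiff n A (fun x => a *: f x + g x).
Proof.
move=> oA; elim: n f g => //= n IH f g [df Df] [dg Dg]; split=> [x Ax|v].
  by apply: differentiableD (dg _ Ax); apply: differentiableZ (df _ Ax).
apply: ndiff_ext (IH _ _ (Df v) (Dg v)) => // x Ax; symmetry.
have fv : derivable f x v by exact/diff_derivable/df.
rewrite [LHS](@deriveD _ _ _ (a \*: f) g).
- by rewrite deriveZ.
- exact: derivableZ.
- exact/diff_derivable/dg.
Qed.

End Smooth.

Lemma ndiff_comp (R : realType) (U V W : normedModType R) n (A : set U)
    (B : set V) (l : {linear U -> V}) (f : V -> W) :
  continuous l -> (forall x, A x -> B (l x)) -> ndiff n B f ->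
  ndiff n A (f \o l).
Proof.
move=> cl AB; elim: n f => //= n IH f [df Df]; split=> [x Ax|v].
  have dl : differentiable l x by exact: linear_differentiable cl.
  exact: differentiable_comp dl (df _ (AB _ Ax)).
suff -> : (fun x => 'D_v (f \o l) x) = (fun y => 'D_(l v) f y) \o l.
  exact: IH.
apply/funext => x /=; rewrite /derive.
by under eq_fun do rewrite /= linearP.
Qed.

Section Manifold.
Variable R : realType.

Record chart (T : topologicalType) (d : nat) := Chart {
  cdom : set T;
  cmap : T -> 'rV[R]_d;
  cinv : 'rV[R]_d -> T;
  cdom_open : open cdom;
  cimg_open : open (cmap @` cdom);
  cmapK : forall m, cdom m -> cinv (cmap m) = m;
  cmap_cont : {within cdom, continuous cmap};
  cinv_cont : {within cmap @` cdom, continuous cinv} }.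

Definition locally_finite (T : topologicalType) (C : set (set T)) : Prop :=
  forall x : T, exists2 N, nbhs x N & finite_set [set A | C A /\ A `&` N !=set0].

Definition paracompact (T : topologicalType) : Prop :=
  forall C : set (set T), (forall A, C A -> open A) ->
    \bigcup_(A in C) A = setT ->
  exists D : set (set T), [/\ forall A, D A -> open A,
    \bigcup_(A in D) A = setT,
    forall A, D A -> exists2 B, C B & A `<=` B & locally_finite D].

(* The atlas is indexed by the points of the manifold, the chart of index m
   being defined at m. Any smooth atlas yields one of this form, with the same
   smooth structure, by choosing one of its charts around each point. *)
Record manifold := Manifold {
  mcarrier :> topologicalType;
  mdim : nat;
  mchart : mcarrier -> chart mcarrier mdim;
  mchart_dom : forall m, cdom (mchart m) m;
  mchart_smooth : forall m n,
    smooth_on (cmap (mchart m) @` (cdom (mchart m) `&` cdom (mchart n)))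
              (cmap (mchart n) \o cinv (mchart m));
  mhausdorff : hausdorff_space mcarrier;
  mparacompact : paracompact mcarrier;
  mconnected : connected [set: mcarrier] }.

End Manifold.

Section BiForms.
Variables (R : realType) (M : manifold R).

(* Every tangent space T_m M is R^d, a tangent vector at m being given by its
   coordinates in the chart [mchart m]. *)
Local Notation T := 'rV[R]_(mdim M).
Local Notation mchart := (@mchart R M).

(* Change of coordinates of tangent vectors at m, from the chart c to c'. *)
Definition tchange (c c' : chart R M (mdim M)) (m : M) (v : T) : T :=
  'D_v (cmap c' \o cinv c) (cmap c m).

Definition field_in (c : chart R M (mdim M)) (X : M -> T) (x : T) : T :=
  tchange (mchart (cinv c x)) c (cinv c x) (X (cinv c x)).

Definition smooth_field (X : M -> T) : Prop := forall m,
  smooth_on (cmap (mchart m) @` cdom (mchart m)) (field_in (mchart m) X).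

Definition bracket (X Y : M -> T) (m : M) : T :=
  'D_(X m) (field_in (mchart m) Y) (cmap (mchart m) m) -
  'D_(Y m) (field_in (mchart m) X) (cmap (mchart m) m).

Definition chart2 (x z : M * M) : T * T :=
  (cmap (mchart x.1) z.1, cmap (mchart x.2) z.2).
Definition chart2_dom (x : M * M) : set (M * M) :=
  cdom (mchart x.1) `*` cdom (mchart x.2).
Definition chart2_inv (x : M * M) (z : T * T) : M * M :=
  (cinv (mchart x.1) z.1, cinv (mchart x.2) z.2).

(* The Lie derivative of a function along X^L = (X, 0). *)
Definition lieL (X : M -> T) (f : M * M -> R) (x : M * M) : R :=
  'D_((X x.1, 0) : T * T) (f \o chart2_inv x) (chart2 x x).

Definition upd n (v : 'I_n -> T) (i : 'I_n) (u : T) : 'I_n -> T :=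
  fun j => if j == i then u else v j.

Definition alternating n (f : ('I_n -> T) -> R) : Prop :=
  (forall v i a u u',
     f (upd v i (a *: u + u')) = a * f (upd v i u) + f (upd v i u')) /\
  (forall v i j, i != j -> v i = v j -> f v = 0).

(* A not necessarily smooth field of forms on M, and a field of bi-forms on
   M x M, the value of which is relevant only near the diagonal. *)
Definition rawform (p : nat) := M -> ('I_p -> T) -> R.
Definition rawbiform (p q : nat) := M * M -> ('I_p -> T) -> ('I_q -> T) -> R.

HB.instance Definition _ p q := GRing.Lmodule.on (rawbiform p q).
HB.instance Definition _ p q := Choice.on (rawbiform p q).

Definition nbhd_diag (U : set (M * M)) : Prop :=
  open U /\ forall m, U (m, m).

Section PQ.
Variables p q : nat.
Implicit Types w : rawbiform p q.

(* Component of w, in the charts of index x.1 and x.2, on the constant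
   vectors v and v'. *)
Definition component w (x : M * M) (v : 'I_p -> T) (v' : 'I_q -> T)
    (z : T * T) : R :=
  let y := chart2_inv x z in
  w y (fun i => tchange (mchart x.1) (mchart y.1) y.1 (v i))
      (fun j => tchange (mchart x.2) (mchart y.2) y.2 (v' j)).

Definition biform_on (U : set (M * M)) w : Prop :=
  [/\ forall x v', U x -> alternating (fun v => w x v v'),
      forall x v, U x -> alternating (fun v' => w x v v') &
      forall x v v', smooth_on (chart2 x @` (U `&` chart2_dom x))
                               (component w x v v')].

Definition local_biform w : Prop := exists2 U, nbhd_diag U & biform_on U w.

Definition local_biform_pred : {pred rawbiform p q} :=
  fun w => `[< local_biform w >].

End PQ.

Lemma chart2_img_open (x : M * M) (U : set (M * M)) :
  open U -> open (chart2 x @` (U `&` chart2_dom x)).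
Proof.
move=> oU; rewrite openE => _ [y [Uy [y1 y2]] <-].
have img m n : cdom (mchart m) n ->
    nbhs (cmap (mchart m) n) (cmap (mchart m) @` cdom (mchart m)).
  by move=> mn; apply: open_nbhs_nbhs; split; [exact: cimg_open|exists n].
have cont m n : cdom (mchart m) n ->
    cinv (mchart m) z @[z --> cmap (mchart m) n] --> n.
  move=> mn; have := @cinv_cont _ _ _ (mchart m).
  rewrite continuous_open_subspace; last exact: cimg_open.
  move/(_ (cmap (mchart m) n)); rewrite inE => /(_ _).
  by rewrite /continuous_at cmapK //; apply; exists n.
have cont2 : chart2_inv x z @[z --> chart2 x y] --> y.
  rewrite [X in _ --> X]surjective_pairing.
  by apply: cvg_pair => /=; apply: cvg_comp (cont _ _ _) => //;
    [exact: cvg_fst|exact: cvg_snd].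
have nU : nbhs (chart2 x y) (chart2_inv x @^-1` U).
  by apply: cont2; apply: open_nbhs_nbhs.
have nI : nbhs (chart2 x y)
    ((cmap (mchart x.1) @` cdom (mchart x.1)) `*`
     (cmap (mchart x.2) @` cdom (mchart x.2))).
  by exists (cmap (mchart x.1) @` cdom (mchart x.1),
             cmap (mchart x.2) @` cdom (mchart x.2)) => //; split; exact: img.
apply: filterS2 nU nI => -[z1 z2] /= Uz [[m xm mz] [n xn nz]].
exists (m, n); last by rewrite /chart2 /= mz nz.
by split=> //; move: Uz; rewrite /chart2_inv /= -mz -nz !cmapK.
Qed.

Section PQ2.
Variables p q : nat.
Implicit Types w : rawbiform p q.

Lemma biform_on_sub (U U' : set (M * M)) w :
  U' `<=` U -> biform_on U w -> biform_on U' w.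
Proof.
move=> UU' [a b s]; split=> [x v /UU'|x v /UU'|x v v' n]; [exact: a|exact: b|].
by apply: ndiff_sub (s x v v' n) => _ [y [/UU' Uy ?] <-]; exists y.
Qed.

Lemma biform_on0 U : biform_on U (0 : rawbiform p q).
Proof.
split=> [x v' _|x v _|x v v' n]; last exact: ndiff0.
- by split=> // v i a u u'; rewrite mulr0 addr0.
- by split=> // v' i a u u'; rewrite mulr0 addr0.
Qed.

Lemma alternating_lin n a (f g : ('I_n -> T) -> R) :
  alternating f -> alternating g -> alternating (fun v => a * f v + g v).
Proof.
move=> [fl fa] [gl ga]; split=> [v i b u u'|v i j ij vij].
  by rewrite fl gl !mulrDr mulrCA addrACA.
by rewrite (fa _ i j) // (ga _ i j) // mulr0 addr0.
Qed.

Lemma biform_on_lin U a w w' : open U ->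
  biform_on U w -> biform_on U w' -> biform_on U (a *: w + w').
Proof.
move=> oU [al ar s] [al' ar' s']; split=> [x v' Ux|x v Ux|x v v' n].
- exact: alternating_lin (al _ _ Ux) (al' _ _ Ux).
- exact: alternating_lin (ar _ _ Ux) (ar' _ _ Ux).
- exact: ndiff_lin (chart2_img_open oU) (s x v v' n) (s' x v v' n).
Qed.

Lemma nbhd_diagT : nbhd_diag setT.
Proof. by split=> //; exact: openT. Qed.

Lemma nbhd_diagI U U' : nbhd_diag U -> nbhd_diag U' -> nbhd_diag (U `&` U').
Proof. by move=> [oU dU] [oU' dU']; split; [exact: openI|]. Qed.

Lemma local_biform_closed : submod_closed (@local_biform_pred p q).
Proof.
split=> [|a w w' /asboolP[U dU Uw] /asboolP[U' dU' Uw']]; apply/asboolP.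
  by exists setT; [exact: nbhd_diagT|exact: biform_on0].
exists (U `&` U'); first exact: nbhd_diagI.
apply: biform_on_lin; first by case: (nbhd_diagI dU dU').
  by apply: biform_on_sub Uw => ? [].
by apply: biform_on_sub Uw' => ? [].
Qed.

HB.instance Definition _ :=
  GRing.isSubmodClosed.Build R (rawbiform p q) (@local_biform_pred p q)
    local_biform_closed.

Record biform := BiForm {
  bfval :> rawbiform p q;
  bfvalP : bfval \in @local_biform_pred p q }.

HB.instance Definition _ := [isSub for bfval].
HB.instance Definition _ := [Choice of biform by <:].
HB.instance Definition _ := [SubChoice_isSubLmodule of biform by <:].

(* The bi-forms vanishing on a neighbourhood of the diagonal. *)
Definition null_biform : {pred biform} :=
  fun w : biform => `[< exists2 U, nbhd_diag U & forall x, U x -> bfval w x = 0 >].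

Lemma null_biform_closed : submod_closed null_biform.
Proof.
split=> [|a w w' /asboolP[U dU Uw] /asboolP[U' dU' Uw']]; apply/asboolP.
  by exists setT => //; exact: nbhd_diagT.
exists (U `&` U') => [|x [Ux U'x]]; first exact: nbhd_diagI.
have -> : bfval (a *: w + w') x = a *: (bfval w x) + bfval w' x by [].
by rewrite Uw // Uw' // scaler0 addr0.
Qed.

HB.instance Definition _ :=
  GRing.isSubmodClosed.Build R biform null_biform null_biform_closed.

(* Omega p q is the space of local bi-forms, two of them being identified when
   they agree on a neighbourhood of the diagonal. *)
Definition Omega := Quotient.quot null_biform.

HB.instance Definition _ := Choice.on Omega.
HB.instance Definition _ := EqQuotient.on Omega.
HB.instance Definition _ := GRing.Zmodule.on Omega.

Definition scale_Omega (a : R) (w : Omega) : Omega := \pi_Omega (a *: repr w).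

Lemma pi_scale a (w : biform) :
  scale_Omega a (\pi_Omega w) = \pi_Omega (a *: w).
Proof.
apply/eqP; rewrite -Quotient.idealrBE -scalerBr rpredZ //.
by rewrite Quotient.idealrBE reprK.
Qed.

Lemma scale_OmegaA a b (w : Omega) :
  scale_Omega a (scale_Omega b w) = scale_Omega (a * b) w.
Proof. by rewrite -[w]reprK !pi_scale ?reprK scalerA. Qed.

Lemma scale_Omega1 (w : Omega) : scale_Omega 1 w = w.
Proof. by rewrite -[w]reprK pi_scale scale1r. Qed.

Lemma scale_OmegaDr : right_distributive scale_Omega +%R.
Proof.
move=> a w w'; rewrite -[w]reprK -[w']reprK.
by rewrite -raddfD !pi_scale ?reprK scalerDr raddfD.
Qed.

Lemma scale_OmegaDl (w : Omega) : {morph scale_Omega^~ w : a b / a + b}.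
Proof. by move=> a b; rewrite -[w]reprK !pi_scale scalerDl raddfD. Qed.

HB.instance Definition _ := GRing.Zmodule_isLmodule.Build R Omega
  scale_OmegaA scale_Omega1 scale_OmegaDr scale_OmegaDl.

Definition germ w (lw : local_biform w) : Omega :=
  \pi_Omega (BiForm (asboolT lw)).

End PQ2.

Definition eval_fields p q (w : rawbiform p q)
    (X : 'I_p -> M -> T) (Y : 'I_q -> M -> T) (x : M * M) : R :=
  w x (fun i => X i x.1) (fun j => Y j x.2).

(* In the second sum, the arguments following the bracket are the fields X_k
   with k different from a and b, in increasing order of k. *)
Definition koszul p q (w : rawbiform p q)
    (X : 'I_p.+1 -> M -> T) (Y : 'I_q -> M -> T) (x : M * M) : R :=
  \sum_(i < p.+1)
     (-1) ^+ i * lieL (X i) (eval_fields w (fun k => X (lift i k)) Y) x +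
  \sum_(a < p.+1) \sum_(b < p.+1 | (a < b)%N)
     (-1) ^+ (a + b) *
     eval_fields w
       (fun k => if k == 0%N :> nat then bracket (X a) (X b)
                 else X (inord (bump b (bump a k.-1)))) Y x.

Definition is_dL p q (w : rawbiform p q) (e : rawbiform p.+1 q) : Prop :=
  exists2 U, nbhd_diag U &
    forall X Y, (forall i, smooth_field (X i)) ->
      (forall j, smooth_field (Y j)) ->
    forall x, U x -> eval_fields e X Y x = koszul w X Y x.

(* [is_dL] does not depend on the representatives of the germs, and determines
   the germ of e; 0 is only the formal default value of [xget]. *)
Definition dL p q (w : Omega p q) : Omega p.+1 q :=
  xget 0 [set e : Omega p.+1 q | is_dL (repr w) (repr e)].

Definition rawdiag p q (w : rawbiform p q) : rawform (p + q) :=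
  fun m z => w (m, m) (fun i => z (lshift q i)) (fun j => z (rshift p j)).

Definition boxtimes p q (a : rawform p) (b : rawform q) : rawbiform p q :=
  fun x v v' => a x.1 v * b x.2 v'.

Definition one_form : rawform 0 := fun _ _ => 1.

Definition diag2 (z : T * T) : T * T := (z.2, z.2).

Lemma diag2_is_linear : linear diag2.
Proof. by []. Qed.

HB.instance Definition _ :=
  GRing.isLinear.Build R (T * T)%type (T * T)%type *:%R diag2 diag2_is_linear.

Lemma diag2_continuous : continuous diag2.
Proof.
move=> z; have z2 : (y : T * T).2 @[y --> z] --> z.2 by exact: cvg_snd.
exact: (cvg_pair z2 z2).
Qed.

Lemma local_biform_one_diag q (w : biform 0 q) :
  local_biform (boxtimes one_form (rawdiag w) : rawbiform 0 q).
Proof.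
have /asboolP[U [oU dU] [_ Ur Us]] := bfvalP w.
pose v0 : 'I_0 -> T := fun=> 0.
have v0E (v : 'I_0 -> T) : v = v0 by apply/funext => -[].
have wE (x : M * M) v v' : boxtimes one_form (rawdiag w) x v v' =
    bfval w (x.2, x.2) v0 v'.
  rewrite /boxtimes /rawdiag mul1r; congr (bfval w _ _ _); first exact: v0E.
  by apply/funext => j; apply: (congr1 v'); exact: val_inj.
exists setT; first exact: nbhd_diagT.
split=> [x v' _|x v _|x v v' n].
- by split=> [v []|v []].
- by under eq_fun do rewrite wE; exact: Ur.
have -> : component (boxtimes one_form (rawdiag w)) x v v' =
    component w (x.2, x.2) v0 v' \o diag2.
  apply/funext => z; rewrite /component /= wE /=.
  by congr (bfval w _ _ _); apply/esym/v0E.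
apply: ndiff_comp diag2_continuous _ (Us (x.2, x.2) v0 v' n).
by move=> _ [y [_ [_ y2]] <-]; exists (y.2, y.2).
Qed.

(* The germ of the bi-form 1 [x] w|_diag. *)
Definition one_diag q (w : Omega 0 q) : Omega 0 q :=
  germ (local_biform_one_diag (repr w)).

(* [JL p q] is J_L^{p+1,q}; the operators J_L^{0,q} take their values in
   the zero space and are omitted. *)
Record left_homotopy_system := LeftHomotopySystem {
  JL : forall p q, {linear Omega p.+1 q -> Omega p q};
  JL_JL : forall p q (w : Omega p.+2 q), JL p q (JL p.+1 q w) = 0;
  JL_homotopy : forall p q (w : Omega p.+1 q),
    dL (JL p q w) + JL p.+1 q (dL w) = w;
  JL_homotopy0 : forall q (w : Omega 0 q), JL 0 q (dL w) = w - one_diag w }.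

Definition AL (J : left_homotopy_system) p q (w : Omega p q) : Omega p q :=
  JL J p q (dL w).

Definition EL (J : left_homotopy_system) p q : Omega p q -> Omega p q :=
  match p with
  | 0 => fun=> 0
  | p'.+1 => fun w => dL (JL J p' q w)
  end.

End BiForms.

Section DirectSum.
Variables (R : pzRingType) (V : lmodType R).
Implicit Types A B : set V.

Definition is_subspace A : Prop :=
  A 0 /\ forall a u v, A u -> A v -> A (a *: u + v).

Definition is_direct_sum A B : Prop :=
  [/\ is_subspace A, is_subspace B,
      forall w, exists u v, [/\ A u, B v & w = u + v] & A `&` B = [set 0]].

End DirectSum.

(* Main.v *)
(** A is J d and E is d J, so once d is known to be linear with d d = 0 both parts
    follow from d J + J d = 1 and J J = 0 : J d J = J gives (a), and w = d J w + J d w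
    splits w, with uniqueness since d u = 0 and J u = 0 force u = 0.

    The work is in the properties of d, which is a choice among the germs that
    satisfy the Koszul formula. Uniqueness holds because every tangent vector
    extends to a global smooth field, by a cut-off. In a chart the Koszul formula
    becomes [sum_i (-1)^i D_{v_i}] of the components, the derivatives of the fields
    cancelling the brackets; hence d d = 0 by the symmetry of second derivatives.
    Existence need not be proved by constructing d w: if d w did not exist, the
    homotopy formula itself would make w exact, hence closed. *)

From HB Require Import structures.
From mathcomp Require Import all_boot all_order all_algebra.
From mathcomp Require Import generic_quotient ring_quotient.
From mathcomp Require Import all_classical all_reals all_analysis.
From mathcomp Require Import ring zify.
(* Last, since MathComp has another [alternating]. *)
Require Import Defs.

Set Implicit Arguments.
Unset Strict Implicit.
Unset Printing Implicit Defensive.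

Import Order.TTheory GRing.Theory Num.Theory.
Import numFieldNormedType.Exports.

Local Open Scope classical_set_scope.
Local Open Scope ring_scope.
Local Open Scope quotient_scope.

(** * Calculus of smooth functions *)

Section NdiffGeneral.
Context {R : realType} {V W : normedModType R}.
Implicit Types (A : set V) (f g : V -> W).

(** A tangent vector at m is given in the chart [mchart m], which varies with m without any
    continuity, and [lieL] and [bracket] likewise work in the chart centred at the point of
    evaluation. A formula proved at each point in its own chart cannot be differentiated again. The
    Koszul formula is therefore brought to charts in two forms: [cartan], at the centre of the chart
    and for arbitrary smooth left fields, and [koszul_component], on a neighbourhood in one fixed
    chart, with fields that are constant there. In d (d w) the outer differential uses the first
    form and the inner one the second.

    Since d is a choice with default value 0, its linearity and d d = 0 are first proved for the
    relation [is_dL]. They pass to [dL] once every germ is known to have a differential; the proof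
    of that may use the linearity of J, but not yet that of d. *)

Lemma ndiffW n A f : ndiff n.+1 A f -> ndiff n A f.
Proof.
by elim: n f => //= n IH f [df Df]; split=> // v; apply: IH; exact: Df.
Qed.

(** The derivatives in [ndiff] are those of f on the whole space; the set only says where
    differentiability is tested, so the condition splits into one condition per point. *)
Lemma ndiff_pointwise n A f :
  (forall x, A x -> ndiff n [set x] f) -> ndiff n A f.
Proof.
elim: n f => //= n IH f Af; split=> [x /Af[df _]|v]; first exact: df.
by apply: IH => x /Af[_]; exact.
Qed.

Lemma ndiff_local n A f :
  (forall x, A x -> exists B, [/\ open B, B x &
    exists2 g, ndiff n B g & forall y, B y -> g y = f y]) -> ndiff n A f.
Proof.
move=> Af; apply: ndiff_pointwise => x /Af[B [oB Bx [g ng gf]]].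
by apply: ndiff_sub (ndiff_ext oB gf ng) => _ ->.
Qed.

Lemma ndiff_cst n A (c : W) : ndiff n A (fun=> c).
Proof.
case: n => //= n; split=> [x _|v]; first exact: differentiable_cst.
by under eq_fun do rewrite derive_cst; exact: ndiff0.
Qed.

Lemma ndiffD n A f g : open A -> ndiff n A f -> ndiff n A g ->
  ndiff n A (fun x => f x + g x).
Proof.
by move=> oA nf ng; apply: ndiff_ext oA _ (ndiff_lin 1 oA nf ng) => x _;
  rewrite scale1r.
Qed.

Lemma ndiff_sum n A I (r : seq I) (F : I -> V -> W) : open A ->
  (forall i, ndiff n A (F i)) -> ndiff n A (fun x => \sum_(i <- r) F i x).
Proof.
move=> oA nF; elim: r => [|i r IH].
  by under eq_fun do rewrite big_nil; exact: ndiff0.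
by under eq_fun do rewrite big_cons; exact: ndiffD.
Qed.

Lemma ndiff_linear n A (l : {linear V -> W}) : continuous l -> ndiff n A l.
Proof.
move=> cl; case: n => //= n; split=> [x _|v].
  exact: linear_differentiable.
have -> : (fun x => 'D_v l x) = (fun=> l v).
  apply/funext => x; rewrite deriveE; last exact: linear_differentiable.
  by rewrite diff_lin.
exact: ndiff_cst.
Qed.

Lemma smooth_differentiable A f x : smooth_on A f -> A x -> differentiable f x.
Proof. by move=> sf Ax; have [+ _] := sf 1%N; exact. Qed.

Lemma smooth_derive A f v : smooth_on A f -> smooth_on A ('D_v f).
Proof. by move=> sf n; have [_] := sf n.+1; exact. Qed.

End NdiffGeneral.

Section NdiffCoord.
Context {R : realType} {V : normedModType R} {d : nat}.
Implicit Types (A : set V).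

Lemma row_coordE (v : 'rV[R]_d) : v = \sum_i v 0 i *: delta_mx 0 i.
Proof. exact: row_sum_delta. Qed.

Lemma derive_coord (f : V -> 'rV[R]_d) x v i : derivable f x v ->
  ('D_v f x) 0 i = 'D_v (fun y => f y 0 i) x.
Proof. by move=> df; rewrite derive_mx// mxE. Qed.

Lemma differentiable_rowP (f : V -> 'rV[R]_d) x :
  (forall i, differentiable (fun y => f y 0 i) x) -> differentiable f x.
Proof.
move=> df; have -> : f = \sum_i (fun y => f y 0 i *: delta_mx 0 i).
  by apply/funext => y; rewrite [LHS]row_coordE fct_sumE.
by apply: differentiable_sum => i; exact: differentiableZl.
Qed.

Lemma ndiff_coord n A (f : V -> 'rV[R]_d) i : open A ->
  ndiff n A f -> ndiff n A (fun y => f y 0 i).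
Proof.
move=> oA; elim: n f => //= n IH f [df Df]; split=> [x Ax|v].
  apply: (@differentiable_comp _ _ _ _ f (fun z : 'rV[R]_d => z 0 i)).
    exact: df.
  exact: differentiable_coord.
apply: ndiff_ext (IH _ (Df v)) => // x Ax.
by rewrite derive_coord//; exact/diff_derivable/df.
Qed.

Lemma ndiff_row n A (f : V -> 'rV[R]_d) : open A ->
  (forall i, ndiff n A (fun y => f y 0 i)) -> ndiff n A f.
Proof.
move=> oA; elim: n f => //= n IH f Cf.
have df x : A x -> differentiable f x.
  by move=> Ax; apply: differentiable_rowP => i; have [+ _] := Cf i; exact.
split=> // v; apply: IH => i; have [_ /(_ v)] := Cf i.
apply: ndiff_ext => // x Ax.
by rewrite derive_coord//; exact/diff_derivable/df.
Qed.

End NdiffCoord.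

Section NdiffMul.
Context {R : realType} {V : normedModType R}.
Implicit Types (A : set V).

Lemma ndiffM n A (f g : V -> R) : open A -> ndiff n A f -> ndiff n A g ->
  ndiff n A (fun x => f x * g x).
Proof.
move=> oA; elim: n f g => // n IH f g nf ng.
have [df Df] := nf; have [dg Dg] := ng; split=> [x Ax|v].
  exact: (differentiableM (df _ Ax) (dg _ Ax)).
have := ndiffD oA (IH _ _ (ndiffW nf) (Dg v)) (IH _ _ (ndiffW ng) (Df v)).
apply: ndiff_ext => // x Ax.
rewrite [RHS](@deriveM _ _ f g) /GRing.scale//=.
  exact/diff_derivable/df.
exact/diff_derivable/dg.
Qed.

Lemma ndiffZ d n A (f : V -> R) (g : V -> 'rV[R]_d) : open A ->
  ndiff n A f -> ndiff n A g -> ndiff n A (fun x => f x *: g x).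
Proof.
move=> oA nf ng; apply: ndiff_row => // i; under eq_fun do rewrite mxE.
exact: ndiffM (ndiff_coord _ _ _).
Qed.

End NdiffMul.

Section ChainRule.
Context {R : realType} {U V W : normedModType R}.

Lemma derive_chain (f : V -> W) (g : U -> V) x v :
  differentiable g x -> differentiable f (g x) ->
  'D_v (f \o g) x = 'D_('D_v g x) f (g x).
Proof.
move=> dg df; rewrite deriveE; last exact: differentiable_comp.
by rewrite diff_comp//= [in RHS]deriveE// deriveE.
Qed.

Lemma derive_linear (f : V -> W) x a u v : differentiable f x ->
  'D_(a *: u + v) f x = a *: 'D_u f x + 'D_v f x.
Proof. by move=> df; rewrite !deriveE// linearP. Qed.

Lemma derive_sumv (f : V -> W) x I (r : seq I) (F : I -> V) (c : I -> R) :
  differentiable f x ->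
  'D_(\sum_(i <- r) c i *: F i) f x = \sum_(i <- r) c i *: 'D_(F i) f x.
Proof.
move=> df; rewrite deriveE// linear_sum; apply: eq_bigr => i _.
by rewrite linearZ deriveE.
Qed.

End ChainRule.

Section NdiffComp.
Context {R : realType} {V : normedModType R} {d : nat}.

(** By the chain rule ['D_v (f \o g)] is the sum of the products of the i-th coordinate of ['D_v g]
    with ['D_(e_i) f \o g], so the induction on n passes from f to its partial derivatives, with the
    same g. Real values of f let [ndiffM] apply. *)
Lemma ndiff_compR n (A : set V) (B : set 'rV[R]_d) (g : V -> 'rV[R]_d)
    (f : 'rV[R]_d -> R) : open A -> (forall x, A x -> B (g x)) ->
  ndiff n A g -> ndiff n B f -> ndiff n A (f \o g).
Proof.
move=> oA AB; elim: n f => // n IH f ng [df Df].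
have [dg Dg] := ng; split=> [x Ax|v].
  exact: differentiable_comp (dg _ Ax) (df _ (AB _ Ax)).
have := ndiff_sum (index_enum 'I_d) oA (fun i =>
  ndiffM oA (ndiff_coord i oA (Dg v)) (IH _ (ndiffW ng) (Df (delta_mx 0 i)))).
apply: ndiff_ext => // x Ax.
rewrite [RHS]derive_chain; [|exact: dg|exact/df/AB].
by rewrite [in RHS](row_coordE ('D_v g x)) derive_sumv//; exact/df/AB.
Qed.

Lemma ndiff_comp_row e n (A : set V) (B : set 'rV[R]_d) (g : V -> 'rV[R]_d)
    (f : 'rV[R]_d -> 'rV[R]_e) : open A -> open B ->
  (forall x, A x -> B (g x)) ->
  ndiff n A g -> ndiff n B f -> ndiff n A (f \o g).
Proof.
move=> oA oB AB ng nf; apply: ndiff_row => // i.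
exact: (ndiff_compR oA AB ng (ndiff_coord i oB nf)).
Qed.

Lemma ndiff_comp1 n (A : set V) (g : V -> R) (f : R -> R) : open A ->
  ndiff n A g -> ndiff n setT f -> ndiff n A (f \o g).
Proof.
move=> oA; elim: n f => // n IH f ng [df Df].
have [dg Dg] := ng; split=> [x Ax|v].
  exact: differentiable_comp (dg _ Ax) (df _ I).
have := ndiffM oA (Dg v) (IH _ (ndiffW ng) (Df 1)).
apply: ndiff_ext => // x Ax.
rewrite [RHS]derive_chain; [|exact: dg|exact/df].
have dfx : differentiable f (g x) by exact: df.
rewrite [RHS](deriveE _ dfx) /= (deriveE (1 : R) dfx).
by rewrite -[in RHS](mulr1 ('D_v g x)) linearZ.
Qed.

End NdiffComp.

(** * Bump functions *)

Section Bump.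
Context {R : realType}.
Implicit Types (k n : nat) (t : R).

(* The span of these functions is stable under derivation. *)
Definition flat k t : R := if 0 < t then t^-1 ^+ k * expR (- t^-1) else 0.

Lemma flat_le0 k t : t <= 0 -> flat k t = 0.
Proof. by rewrite /flat leNgt => /negbTE ->. Qed.

Lemma flat_gt0 k t : 0 < t -> 0 < flat k t.
Proof. by move=> t0; rewrite /flat t0 mulr_gt0 ?expR_gt0// exprn_gt0 ?invr_gt0. Qed.

(** With u = 1/t, this is u^(k+2) / (k+2)! <= exp u, a term of the exponential series. The square of
    t leaves a factor t in the difference quotient at 0. *)
Lemma flat_quadratic k t : `|flat k t| <= k.+2`!%:R * t ^+ 2.
Proof.
have [t0|t0] := ltP 0 t; last first.
  by rewrite flat_le0// normr0 mulr_ge0 ?sqr_ge0.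
rewrite gtr0_norm ?flat_gt0// /flat t0 expRN.
have u0 : 0 < t^-1 by rewrite invr_gt0.
have -> : t ^+ 2 = t^-1 ^- 2 by rewrite -exprVn invrK.
set u := t^-1 in u0 *.
rewrite ler_pdivrMr ?expR_gt0//.
have := expR_ge1Dxn k.+1 (ltW u0).
have fk : (0 : R) < k.+2`!%:R by rewrite ltr0n fact_gt0.
have -> : u ^+ k = k.+2`!%:R * u ^- 2 * (u ^+ k.+2 / k.+2`!%:R).
  have -> : u ^+ k.+2 = u ^+ 2 * u ^+ k by rewrite -exprD.
  by field; rewrite !gt_eqF.
move=> le; rewrite ler_pM2l; last by rewrite mulr_gt0// invr_gt0 exprn_gt0.
by apply: le_trans le; rewrite lerDr.
Qed.

Lemma is_derive_flat k t :
  is_derive t 1 (flat k) (flat k.+2 t - k%:R * flat k.+1 t).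
Proof.
have [t0|t0|->] := ltgtP t 0.
- rewrite !flat_le0 ?ltW// mulr0 subr0.
  apply: (@near_eq_is_derive _ _ _ (cst 0)).
  near=> s; rewrite flat_le0//; near: s.
  by apply: filterS (lt_nbhsl t0) => s /ltW.
- apply: (@near_eq_is_derive R R R (fun s : R => s^-1 ^+ k * expR (- s^-1))
    (flat k) t 1 _).
    by apply: filterS (lt_nbhsr t0) => s s0; rewrite /flat s0.
  have tn0 : t != 0 by rewrite gt_eqF.
  rewrite /flat t0.
  have inv : is_derive t 1 (fun s : R => s^-1) (- t ^- 2).
    have := @is_deriveV R id t 1 1 tn0 (is_derive_id _ _).
    by rewrite /GRing.scale/= mulr1.
  have dk : is_derive t 1 (fun s : R => s^-1 ^+ k)
      (k%:R * t^-1 ^+ k.-1 * (- t ^- 2)).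
    have := @is_deriveX R R _ k _ _ _ inv.
    have -> : (fun s : R => s^-1) ^+ k = (fun s => s^-1 ^+ k).
      by apply/funext => s; rewrite exprfctE.
    by [].
  have de : is_derive t 1 (fun s : R => expR (- s^-1)) (t ^- 2 * expR (- t^-1)).
    have dN : is_derive t 1 (fun s : R => - s^-1) (t ^- 2).
      have := @is_deriveN R R R _ _ _ _ inv; by rewrite opprK.
    have := @is_derive1_comp R expR (fun s => - s^-1) t _ _ (is_derive_expR _) dN.
    by rewrite mulrC.
  apply: is_derive_eq; rewrite /GRing.scale/=.
  (* The power rule produces the exponent [k.-1], so k = 0 is computed apart. *)
  case: k {dk} => [|k]; first by rewrite /= !expr0 !expr2; field.
  by rewrite /= !exprS; field.
(* At 0 the difference quotient is at most (k+2)! |h| by [flat_quadratic]. *)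
- rewrite !flat_le0// mulr0 subr0.
  have lim0 : h^-1 *: (flat k (h *: 1 + 0) - flat k 0) @[h --> 0^'] --> (0:R).
    apply/cvgrPdist_le => e e0; near=> h.
    have hn0 : h != 0 by near: h; exact: nbhs_dnbhs_neq.
    rewrite sub0r normrN (@flat_le0 k 0)// subr0 addr0 [h *: 1]mulr1 normrM normfV.
    rewrite ler_pdivrMl ?normr_gt0//.
    apply: le_trans (flat_quadratic k h) _.
    rewrite -normr_id -[h ^+ 2]ger0_norm ?sqr_ge0// normrX expr2 mulrA mulrC.
    rewrite normr_id ler_pM2l ?normr_gt0//.
    have fk : (0 : R) < k.+2`!%:R by rewrite ltr0n fact_gt0.
    rewrite -ler_pdivlMl// mulrC.
    near: h; apply: dnbhs0_le; exact: divr_gt0.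
  apply: DeriveDef; last exact: cvg_lim lim0.
  by apply/cvg_ex; exists 0.
Unshelve. all: by end_near. Qed.

Lemma flat_differentiable k t : differentiable (flat k) t.
Proof. by apply/derivable1_diffP; have [] := is_derive_flat k t. Qed.

Lemma ndiff_flat n k A : ndiff n A (flat k).
Proof.
suff : ndiff n setT (flat k) by apply: ndiff_sub.
elim: n k => // n IH k; split=> [x _|v]; first exact: flat_differentiable.
have := ndiff_lin v openT
  (ndiff_lin (- k%:R) openT (IH k.+1) (IH k.+2)) (ndiff0 n setT).
apply: ndiff_ext; first exact: openT.
move=> x _; rewrite (deriveE v (flat_differentiable k x)).
rewrite -[X in 'd _ _ X](mulr1 v) linearZ -deriveE//; last exact: flat_differentiable.
have [_ ->] := is_derive_flat k x.
by rewrite addr0 scaleNr addrC.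
Qed.

(** As [flat 0] vanishes on t <= 0 and increases afterwards, the inner difference is constant for t
    <= 0 and nonpositive for t >= a. Nesting two copies of [flat 0] leaves a constant denominator,
    so that no quotient of functions has to be differentiated. *)
Definition plateau (a t : R) : R := flat 0 (flat 0 a - flat 0 t) / flat 0 (flat 0 a).

Lemma plateau_le0 a t : 0 < a -> t <= 0 -> plateau a t = 1.
Proof.
move=> a0 t0; rewrite /plateau (flat_le0 _ t0) subr0 divff// gt_eqF//.
exact/flat_gt0/flat_gt0.
Qed.

Lemma plateau_ge a t : 0 < a -> a <= t -> plateau a t = 0.
Proof.
move=> a0 at_; rewrite /plateau flat_le0 ?mul0r// subr_le0.
rewrite /flat a0 (lt_le_trans a0 at_) !expr0 !mul1r ler_expR lerN2.
by rewrite lef_pV2// posrE ?(lt_le_trans a0 at_).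
Qed.

Lemma ndiff_plateau n a A : ndiff n A (plateau a).
Proof.
suff : ndiff n setT (plateau a) by apply: ndiff_sub.
have nf : ndiff n setT (fun t => flat 0 a - flat 0 t).
  have := ndiff_lin (-1) openT (ndiff_flat n 0 setT) (ndiff_cst n setT (flat 0 a)).
  by apply: ndiff_ext; [exact: openT|move=> x _; rewrite scaleN1r addrC].
have := ndiff_lin (flat 0 (flat 0 a))^-1 openT
  (ndiff_comp1 openT nf (ndiff_flat n 0 setT)) (ndiff0 n setT).
by apply: ndiff_ext; [exact: openT|move=> x _; rewrite addr0 [LHS]mulrC].
Qed.

(** The squared Euclidean distance replaces the norm of ['rV_d], a maximum, which is not smooth. The
    plateau falls from 1 to 0 as this square runs from r^2/2 to r^2; the Euclidean ball of radius r
    lies in the ball of the maximum norm. *)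
Definition bump_fun d (c : 'rV[R]_d) (r : R) (x : 'rV[R]_d) : R :=
  plateau (r ^+ 2 / 2) (\sum_i (x 0 i - c 0 i) ^+ 2 - r ^+ 2 / 2).

Lemma ndiff_sqr_dist d (c : 'rV[R]_d) n A :
  ndiff n A (fun x : 'rV[R]_d => \sum_i (x 0 i - c 0 i) ^+ 2).
Proof.
suff : ndiff n setT (fun x : 'rV[R]_d => \sum_i (x 0 i - c 0 i) ^+ 2).
  by apply: ndiff_sub.
apply: ndiff_sum => [|i]; first exact: openT.
under eq_fun do rewrite expr2.
have nc : ndiff n setT (fun x : 'rV[R]_d => x 0 i - c 0 i).
  apply: ndiffD (ndiff_cst _ _ _); first exact: openT.
  apply: (ndiff_coord i openT (f := id)).
  by apply: (@ndiff_linear _ _ _ n setT idfun) => ?; exact: cvg_id.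
exact: (ndiffM openT nc nc).
Qed.

Lemma ndiff_bump_fun d (c : 'rV[R]_d) r n A : ndiff n A (bump_fun c r).
Proof.
suff : ndiff n setT (bump_fun c r) by apply: ndiff_sub.
apply: (ndiff_comp1 openT _ (ndiff_plateau n (r ^+ 2 / 2) setT)).
apply: ndiffD openT _ (ndiff_cst _ _ _); exact: ndiff_sqr_dist.
Qed.

Lemma bump_fun_near1 d (c : 'rV[R]_d) r : 0 < r -> \forall x \near c, bump_fun c r x = 1.
Proof.
move=> r0; have r20 : 0 < r ^+ 2 / 2 by rewrite divr_gt0// exprn_gt0.
have cs : {for c, continuous (fun x : 'rV[R]_d => \sum_i (x 0 i - c 0 i) ^+ 2)}.
  apply: differentiable_continuous.
  by have [+ _] := @ndiff_sqr_dist d c 1 setT; apply.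
have s0 : \sum_i (c 0 i - c 0 i) ^+ 2 < r ^+ 2 / 2.
  by rewrite big1// => i _; rewrite subrr expr0n.
have : \forall x \near c, \sum_i ((x : 'rV[R]_d) 0 i - c 0 i) ^+ 2 < r ^+ 2 / 2.
  exact: (cvgr_lt _ cs).
apply: filterS => x xr.
by rewrite /bump_fun plateau_le0// subr_le0 ltW.
Qed.

Lemma bump_fun_out d (c : 'rV[R]_d) r x : 0 < r -> ~ closed_ball c r x ->
  bump_fun c r x = 0.
Proof.
move=> r0 xr; apply: plateau_ge; first by rewrite divr_gt0// exprn_gt0.
rewrite lerBrDr -splitr.
suff [i xi] : exists i, r < `|x 0 i - c 0 i|.
  rewrite (bigD1 i)//=; apply: ler_wpDr.
    by apply: sumr_ge0 => j _; exact: sqr_ge0.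
  by rewrite -[leRHS]real_normK ?num_real// lerXn2r// ?nnegrE ?ltW.
apply: contrapT => H; apply: xr; rewrite closed_ballE// /closed_ball_/=.
rewrite /Num.Def.normr/= mx_normrE (bigmax_le _ (ltW r0))//= => -[i j] _.
rewrite leNgt; apply/negP => rij; apply: H; exists j.
by rewrite distrC; move: rij; rewrite !mxE/= (ord1 i).
Qed.
End Bump.

(** * Alternating forms *)

Section Combinatorics.
Context {R : numDomainType}.

(** The entry k of the list without i is the index k when k < i and k + 1 otherwise. The second case
    changes the sign, so each pair a < b occurs twice with opposite signs. This one computation
    serves both the cancellation of the brackets and d d = 0. *)
Lemma signed_pairs n (G : 'I_n.+1 -> 'I_n.+1 -> R) :
  \sum_(i < n.+1) \sum_(k < n) (-1) ^+ (i + k) * G i (lift i k) =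
  \sum_(a < n.+1) \sum_(b < n.+1 | (a < b)%N) (-1) ^+ (a + b) * (G b a - G a b).
Proof.
have E (i : 'I_n.+1) : \sum_(k < n) (-1) ^+ (i + k) * G i (lift i k) =
    \sum_(j < n.+1 | (j < i)%N) (-1) ^+ (i + j) * G i j -
    \sum_(j < n.+1 | (i < j)%N) (-1) ^+ (i + j) * G i j.
  rewrite [in RHS]big_mkcond [X in _ - X]big_mkcond/= -sumrB (bigD1_ord i)//=.
  rewrite !ltnn subr0 add0r; apply: eq_bigr => k _.
  rewrite /bump; case: (leqP i k) => ik.
    rewrite add1n !ltnS ik ltnNge (leqW ik) /= sub0r addnS exprS mulN1r.
    by rewrite mulNr opprK.
  by rewrite add0n ik ltnNge (ltnW ik) subr0.
rewrite (eq_bigr _ (fun i _ => E i)) sumrB (exchange_big_dep predT)//= -sumrB.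
apply: eq_bigr => a _; rewrite -sumrB; apply: eq_bigr => b ab.
by rewrite mulrBr addnC.
Qed.

Lemma signed_pairs_sym n (G : 'I_n.+1 -> 'I_n.+1 -> R) :
  (forall i j, G i j = G j i) ->
  \sum_(i < n.+1) \sum_(k < n) (-1) ^+ (i + k) * G i (lift i k) = 0.
Proof.
move=> Gsym; rewrite signed_pairs big1// => a _; rewrite big1// => b _.
by rewrite Gsym subrr mulr0.
Qed.

End Combinatorics.

Section Alternating.
Context {R : realType} {M : manifold R}.
Local Notation T := 'rV[R]_(mdim M).

Definition multilinear n (f : ('I_n -> T) -> R) : Prop :=
  forall v i a u u', f (upd v i (a *: u + u')) = a * f (upd v i u) + f (upd v i u').

Lemma multilinear_sum n (f : ('I_n -> T) -> R) v i I (r : seq I)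
    (c : I -> R) (F : I -> T) : multilinear f ->
  f (upd v i (\sum_(j <- r) c j *: F j)) = \sum_(j <- r) c j * f (upd v i (F j)).
Proof.
move=> fl; elim: r => [|j r IH]; last by rewrite !big_cons fl IH.
rewrite !big_nil; have := fl v i (-1) 0 0.
by rewrite scaler0 addr0 mulN1r addNr.
Qed.

Lemma multilinear_coord n (f : ('I_n -> T) -> R) v i u : multilinear f ->
  f (upd v i u) = \sum_j u 0 j * f (upd v i (delta_mx 0 j)).
Proof. by move=> fl; rewrite [in LHS](row_coordE u) multilinear_sum. Qed.

Lemma upd_id n (v : 'I_n -> T) i : upd v i (v i) = v.
Proof. by apply/funext => j; rewrite /upd; case: eqP => [->|]. Qed.

Lemma updC n (v : 'I_n -> T) i j u u' : i != j ->
  upd (upd v i u) j u' = upd (upd v j u') i u.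
Proof.
move=> ij; apply/funext => k; rewrite /upd.
by case: eqP => // ->; rewrite eq_sym (negbTE ij).
Qed.

Lemma alternating_swap n (f : ('I_n -> T) -> R) v i j u u' :
  alternating f -> i != j ->
  f (upd (upd v i u) j u') = - f (upd (upd v i u') j u).
Proof.
move=> [fl fa] ij.
have f0 w : f (upd (upd v i w) j w) = 0.
  by apply: (fa _ i j) => //; rewrite /upd eqxx (negbTE ij) eqxx.
have := f0 (1 *: u + u'); rewrite fl !(updC _ _ _ ij) !fl -!(updC _ _ _ ij) !f0.
by rewrite !mul1r add0r addr0 => /eqP; rewrite addr_eq0 => /eqP ->; rewrite opprK.
Qed.

Definition ins p (k : 'I_p.+1) (u : T) (r : 'I_p -> T) : 'I_p.+1 -> T :=
  fun j => if unlift k j is Some l then r l else u.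

Lemma ins_eq p (k : 'I_p.+1) u r : ins k u r k = u.
Proof. by rewrite /ins unlift_none. Qed.

Lemma ins_lift p (k : 'I_p.+1) u r l : ins k u r (lift k l) = r l.
Proof. by rewrite /ins liftK. Qed.

Lemma upd_ins p (v : 'I_p.+1 -> T) k u : upd v k u = ins k u (v \o lift k).
Proof.
apply/funext => j; rewrite /upd /ins.
by case: unliftP => [l ->|->]; rewrite ?eqxx// eq_sym (negbTE (neq_lift _ _)).
Qed.

(** The product rule differentiates the field in slot k, whereas the Koszul formula puts the bracket
    in slot 0; moving the argument across k others costs the sign. *)
Lemma alternating_ins p (f : ('I_p.+1 -> T) -> R) (k : 'I_p.+1) u r :
  alternating f -> f (ins k u r) = (-1) ^+ k * f (ins ord0 u r).
Proof.
move=> fa; case: k => k kp; elim: k kp => [|k IH] kp /=.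
  by rewrite mul1r; congr (f (ins _ u r)); exact: val_inj.
have kp' := ltnW kp; rewrite exprS mulN1r mulNr -(IH kp').
have kp1 : (k < p)%N by [].
pose k0 := Ordinal kp'; pose k1 := Ordinal kp; pose l0 := Ordinal kp1.
have k01 : k0 != k1 by rewrite -val_eqE /= neq_ltn ltnSn.
have e1 : k1 = lift k0 l0 by apply: val_inj; rewrite /= /bump leqnn.
have e0 : k0 = lift k1 l0 by apply: val_inj; rewrite /= /bump ltnn.
(* Insertion at k + 1 is insertion at k followed by the exchange of the slots k and k + 1. *)
have -> : ins k1 u r = upd (upd (ins k0 u r) k0 (r l0)) k1 u.
  apply/funext => j; rewrite /upd; case: eqP => [->|/eqP jk1].
    by rewrite ins_eq.
  case: eqP => [->|/eqP jk0]; first by rewrite e0 ins_lift.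
  case: (unliftP k1 j) jk1 jk0 => [l ->|->]; last by rewrite eqxx.
  move=> _; rewrite ins_lift -val_eqE /= => jk0.
  have -> : lift k1 l = lift k0 l; last by rewrite ins_lift.
  apply: val_inj => /=; move: jk0; rewrite /bump; case: ltngtP => //=.
  by move=> ->; rewrite eqxx.
rewrite alternating_swap//; congr (- f _).
apply/funext => j; rewrite /upd; case: eqP => [->|_].
  by rewrite e1 ins_lift.
by case: eqP => // ->; rewrite ins_eq.
Qed.

(** Sorting the two omitted indices makes the list symmetric in i and j, and for i < j it agrees
    with the argument list that follows the bracket in [koszul]. *)
Definition rest p (x : 'I_p.+2 -> T) (i j : 'I_p.+2) (k : 'I_p) : T :=
  x (inord (bump (maxn i j) (bump (minn i j) k))).

Lemma restC p (x : 'I_p.+2 -> T) i j : rest x i j = rest x j i.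
Proof. by apply/funext => k; rewrite /rest maxnC minnC. Qed.

(** A simplicial identity: two successive omissions are rewritten with the larger index
    outermost. *)
Lemma bump_rest i k l : bump i (bump k l) =
  bump (maxn i (bump i k)) (bump (minn i (bump i k)) l).
Proof.
rewrite /bump; case: (leqP i k) => ik.
  by rewrite add1n (maxn_idPr (leqW ik)) (minn_idPl (leqW ik));
    case: (leqP k l) => kl; case: (leqP i l) => il /=;
    do ?[case: leqP => ? /=]; lia.
by rewrite add0n (maxn_idPl (ltnW ik)) (minn_idPr (ltnW ik)).
Qed.

Lemma rest_lift p (x : 'I_p.+2 -> T) i k :
  x \o lift i \o lift k = rest x i (lift i k).
Proof.
apply/funext => l; congr x; apply: val_inj; rewrite /= inordK -bump_rest//.
exact: (ltn_ord (lift i (lift k l))).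
Qed.

(* The derivatives of the fields in the first sum of the Koszul formula cancel
   the terms of the brackets. *)
Lemma koszul_cancelS p (f : ('I_p.+1 -> T) -> R) (x : 'I_p.+2 -> T)
    (m : 'I_p.+2 -> 'I_p.+2 -> T) : alternating f ->
  \sum_(i < p.+2) (-1) ^+ i *
     (\sum_(k < p.+1) f (upd (x \o lift i) k (m i (lift i k)))) +
  \sum_(a < p.+2) \sum_(b < p.+2 | (a < b)%N) (-1) ^+ (a + b) *
     f (fun k => if k == 0%N :> nat then m a b - m b a
                 else x (inord (bump b (bump a k.-1)))) = 0.
Proof.
move=> fa; pose g i j := f (ins ord0 (m i j) (rest x i j)).
have E1 (i : 'I_p.+2) :
    (-1) ^+ i * (\sum_(k < p.+1) f (upd (x \o lift i) k (m i (lift i k)))) =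
    \sum_(k < p.+1) (-1) ^+ (i + k) * g i (lift i k).
  rewrite mulr_sumr; apply: eq_bigr => k _.
  by rewrite upd_ins alternating_ins// mulrA -exprD rest_lift.
rewrite (eq_bigr _ (fun i _ => E1 i)) signed_pairs -big_split/= big1// => a _.
rewrite -big_split/= big1// => b ab; rewrite -mulrDr.
set h := (X in f X).
have -> : f h = g a b - g b a; last by rewrite addrA subrK subrr mulr0.
(* The bracket in slot 0 is put into the form [a *: u + u'] in which linearity is stated. *)
have -> : h = upd (ins ord0 0 (rest x a b)) ord0 (-1 *: m b a + m a b).
  apply/funext => k; rewrite /h /upd -val_eqE /=.
  case: (unliftP ord0 k) => [l ->|->]; last by rewrite eqxx scaleN1r addrC.
  by rewrite /= ins_lift /rest (maxn_idPr (ltnW ab)) (minn_idPl (ltnW ab)).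
rewrite (proj1 fa) mulN1r addrC; congr (f _ - f _).
  by apply/funext => k; rewrite /upd /ins; case: unliftP => [l ->|->].
rewrite restC.
by apply/funext => k; rewrite /upd /ins; case: unliftP => [l ->|->].
Qed.

Lemma koszul_cancel p (f : ('I_p -> T) -> R) (x : 'I_p.+1 -> T)
    (m : 'I_p.+1 -> 'I_p.+1 -> T) : alternating f ->
  \sum_(i < p.+1) (-1) ^+ i *
     (\sum_(k < p) f (upd (x \o lift i) k (m i (lift i k)))) +
  \sum_(a < p.+1) \sum_(b < p.+1 | (a < b)%N) (-1) ^+ (a + b) *
     f (fun k => if k == 0%N :> nat then m a b - m b a
                 else x (inord (bump b (bump a k.-1)))) = 0.
Proof.
case: p f x m => [|p] f x m fa; last exact: (koszul_cancelS x m fa).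
rewrite [X in X + _]big1 => [|i _]; last by rewrite big_ord0 mulr0.
by rewrite add0r big1// => a _; rewrite big1// => b; rewrite !ord1.
Qed.

(** * Product rule for a multilinear form evaluated on variable vectors *)

Section ProductRule.
Context {V : normedModType R} {n : nat}.
Variables (F : V -> ('I_n -> T) -> R) (xi : 'I_n -> V -> T) (z0 u : V).
Hypothesis Flin : \forall z \near z0, multilinear (F z).
Hypothesis Fder : forall v, derivable (fun z => F z v) z0 u.
Hypothesis xider : forall k, derivable (xi k) z0 u.

Let mix m (c : 'I_n -> T) z (k : 'I_n) := if (k < m)%N then xi k z else c k.

Lemma derive_multilinear v i w :
  'D_u (fun z => F z (upd v i w)) z0 =
  \sum_j w 0 j * 'D_u (fun z => F z (upd v i (delta_mx 0 j))) z0.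
Proof.
rewrite (@near_eq_derive _ _ _ _
    (\sum_j (w 0 j \*: (fun z => F z (upd v i (delta_mx 0 j)))))); last first.
  by apply: filterS Flin => z lF; rewrite fct_sumE multilinear_coord.
rewrite derive_sum; last by move=> j; exact: derivableZ.
by apply: eq_bigr => j _; rewrite deriveZ.
Qed.

(** The constants are replaced by the vectors [xi k] one slot at a time: [mix m c] has the first m
    slots filled. The new slot is expanded in the standard basis, so each stage differentiates only
    products of real functions, and derivability of F at constant arguments is enough to start. *)
Lemma is_derive_multilinear : is_derive z0 u (fun z => F z (fun k => xi k z))
  ('D_u (fun z => F z (fun k => xi k z0)) z0 +
   \sum_k F z0 (upd (fun k => xi k z0) k ('D_u (xi k) z0))).
Proof.
have Fl0 := nbhs_singleton Flin.
suff H m c : (m <= n)%N -> is_derive z0 u (fun z => F z (mix m c z))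
  ('D_u (fun z => F z (mix m c z0)) z0 +
   \sum_(k < n | (k < m)%N) F z0 (upd (mix m c z0) k ('D_u (xi k) z0))).
  have mixn z : mix n (fun=> 0) z = fun k => xi k z.
    by apply/funext => k; rewrite /mix ltn_ord.
  have := H n (fun=> 0) (leqnn n).
  under eq_fun do rewrite mixn.
  rewrite !mixn; under eq_bigl do rewrite ltn_ord.
  by [].
elim: m c => [|m IH] c mn.
  have mix0 z : mix 0 c z = c by apply/funext.
  under eq_fun do rewrite mix0.
  rewrite mix0 big1 ?addr0//; exact: (derivableP (Fder c)).
pose k0 := Ordinal mn.
have mixS z : mix m.+1 c z = upd (mix m c z) k0 (xi k0 z).
  apply/funext => k; rewrite /mix /upd -val_eqE /= ltnS leq_eqVlt.
  by case: eqP => //= km; congr xi; exact: val_inj.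
have mix_upd v z : mix m (upd c k0 v) z = upd (mix m c z) k0 v.
  apply/funext => k; rewrite /mix /upd -val_eqE /=.
  by case: eqP => // ->; rewrite ltnn.
pose e (j : 'I_(mdim M)) : T := delta_mx 0 j.
(* Slot k0 still holds a constant at stage m, which may be taken to be a basis vector. *)
have dIH j := IH (upd c k0 (e j)) (ltnW mn).
have dxi j : is_derive z0 u (fun z => xi k0 z 0 j) ('D_u (xi k0) z0 0 j).
  rewrite derive_coord//; apply: derivableP; exact: (derivable_mxP _ _ _).1.
have dS := is_derive_sum (fun j => is_deriveM (dxi j) (dIH j)).
apply: (@near_eq_is_derive _ _ _ _ _ _ _ _ _ (is_derive_eq dS _)).
  apply: filterS Flin => z lF; rewrite fct_sumE mixS multilinear_coord//.
  by apply: eq_bigr => j _; rewrite [LHS]/( _ * _) mix_upd.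
rewrite big_split/= mixS; under eq_bigr do rewrite scalerDr; rewrite big_split/=.
rewrite -addrA; congr (_ + _).
  rewrite [RHS]derive_multilinear; apply: eq_bigr => j _.
  by under eq_fun do rewrite mix_upd.
(* The term k0 differentiates the slot just filled; the others come from the induction
   hypothesis. *)
rewrite [RHS](bigD1 k0)/= ?ltnSn// addrC; congr (_ + _).
  rewrite [RHS](_ : _ = F z0 (upd (mix m c z0) k0 ('D_u (xi k0) z0))); last first.
    by congr F; apply/funext => k; rewrite /upd; case: eqP.
  rewrite multilinear_coord//; apply: eq_bigr => j _.
  by rewrite mix_upd [LHS]mulrC.
under eq_bigr do rewrite scaler_sumr; rewrite exchange_big/=.
apply: eq_big => [k|k km].
  by rewrite -val_eqE /=; lia.
have kk0 : k != k0 by rewrite -val_eqE/= ltn_eqF.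
have k0k : k0 != k by rewrite eq_sym.
rewrite (updC _ _ _ k0k) [RHS]multilinear_coord//; apply: eq_bigr => j _.
by rewrite mix_upd (updC _ _ _ k0k).
Qed.

End ProductRule.

End Alternating.

(** * Symmetry of second derivatives *)

Section Schwarz.
Context {R : realType} {V : normedModType R}.

Lemma MVT_line (f : V -> R) p w (t : R) : 0 < t ->
  (forall b, 0 <= b <= t -> differentiable f (p + b *: w)) ->
  exists2 b, 0 <= b <= t & f (p + t *: w) - f p = t * 'D_w f (p + b *: w).
Proof.
move=> t0 df; pose l (b : R) := p + b *: w; pose g := f \o l.
have dl (b : R) : differentiable l b.
  by apply: differentiableD => //; exact: differentiableZl.
have Dl (b : R) : 'D_1 l b = w.
  rewrite deriveD; [|exact: derivable_cst|exact/diff_derivable/differentiableZl].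
  rewrite derive_cst add0r deriveE; last exact: differentiableZl.
  by rewrite diffZl// -deriveE// derive_id scale1r.
have dg b : 0 <= b <= t -> is_derive b 1 g ('D_w f (l b)).
  move=> bt; apply: DeriveDef.
    by apply/diff_derivable; apply: differentiable_comp => //; exact: df.
  by rewrite derive_chain ?Dl//; exact: df.
have [b||b] := @MVT R g (fun b => 'D_w f (l b)) 0 t t0.
- by rewrite in_itv/= => /andP[/ltW b0 /ltW bt]; apply: dg; rewrite b0 bt.
- apply: continuous_in_subspaceT => b; rewrite inE/= in_itv/= => bt.
  by apply: differentiable_continuous; apply: differentiable_comp => //; exact: df.
rewrite in_itv/= => /andP[/ltW b0 /ltW bt]; rewrite /g/= {2}/l scale0r addr0 subr0.
by rewrite mulrC => E; exists b => //; rewrite b0 bt.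
Qed.

(** The mean value theorem is applied to y |-> f (y + t v) - f y along u, then to ['D_u f] along
    v. *)
Lemma second_difference (f : V -> R) (A : set V) x u v t : open A -> 0 < t ->
  ndiff 2 A f ->
  (forall a b, 0 <= a <= t -> 0 <= b <= t -> A (x + a *: u + b *: v)) ->
  exists a b, [/\ 0 <= a <= t, 0 <= b <= t &
    f (x + t *: u + t *: v) - f (x + t *: v) - (f (x + t *: u) - f x) =
    t ^+ 2 * 'D_v ('D_u f) (x + a *: u + b *: v)].
Proof.
move=> oA t0 [df /(_ u)[dDf _]] Ax.
have tt : 0 <= t <= t by rewrite lexx ltW.
have t00 : 0 <= (0 : R) <= t by rewrite lexx ltW.
pose g y := f (y + t *: v) - f y.
have dshift y : A (y + t *: v) -> differentiable (fun y => f (y + t *: v)) y.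
  move=> Ay; apply: (@differentiable_comp _ _ _ _ (fun y => y + t *: v) f).
    by apply: differentiableD.
  exact: df.
have Ax0 a : 0 <= a <= t -> A (x + a *: u).
  by move=> /Ax/(_ t00); rewrite scale0r addr0.
have [a at_ Ea] : exists2 a, 0 <= a <= t &
    g (x + t *: u) - g x = t * 'D_u g (x + a *: u).
  apply: (MVT_line t0) => b bt.
  apply: differentiableB; [exact: dshift (Ax _ _ bt tt)|exact: df (Ax0 _ bt)].
have [b bt Eb] : exists2 b, 0 <= b <= t &
    'D_u f (x + a *: u + t *: v) - 'D_u f (x + a *: u) =
    t * 'D_v ('D_u f) (x + a *: u + b *: v).
  apply: (@MVT_line ('D_u f) (x + a *: u) v t t0) => b bt.
  exact: (dDf _ (Ax _ _ at_ bt)).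
exists a, b; split => //; rewrite expr2 -mulrA -Eb.
have <- : 'D_u g (x + a *: u) = 'D_u f (x + a *: u + t *: v) - 'D_u f (x + a *: u).
  rewrite [LHS]deriveB; [|exact/diff_derivable/dshift/Ax|exact/diff_derivable/df/Ax0].
  congr (fun s => s - 'D_u f (x + a *: u)).
  rewrite (@derive_chain _ _ _ _ f (fun y => y + t *: v)); last 2 first.
  - by apply: differentiableD.
  - exact/df/Ax.
  by rewrite deriveD// derive_id derive_cst addr0.
by rewrite -Ea /g; ring.
Qed.

(** The second difference is symmetric in u and v, so the two mixed derivatives take a common value
    at two points close to x; each is within e / 2 of its value at x by continuity. *)
Lemma schwarz (f : V -> R) (A : set V) x u v : open A -> A x -> smooth_on A f ->
  'D_u ('D_v f) x = 'D_v ('D_u f) x.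
Proof.
move=> oA Ax sf.
have cD w w' : {for x, continuous ('D_w ('D_w' f))}.
  apply: differentiable_continuous.
  exact: smooth_differentiable (smooth_derive _ (smooth_derive _ sf)) Ax.
apply/eqP; rewrite -subr_eq0 -normr_le0; apply/ler_addgt0Pr => e e0.
rewrite add0r.
have e20 : 0 < e / 2 by rewrite divr_gt0.
have near_cst (g : V -> R) : {for x, continuous g} ->
    nbhs x [set y | `|g x - g y| < e / 2].
  by move=> /cvgrPdist_lt/(_ _ e20).
have nA : nbhs x A by exact: open_nbhs_nbhs.
have : nbhs x (A `&` [set y | `|'D_u ('D_v f) x - 'D_u ('D_v f) y| < e / 2]
    `&` [set y | `|'D_v ('D_u f) x - 'D_v ('D_u f) y| < e / 2]).
  apply: filterI (near_cst _ (cD v u)); exact: filterI nA (near_cst _ (cD u v)).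
move=> /nbhs_ballP[r /= r0 xr].
have s0 : 0 < `|u| + `|v| + 1 by rewrite ltr_wpDl// addr_ge0.
(* This gives t (|u| + |v| + 1) = r / 2 < r, which keeps the parallelogram in the ball; the summand
   1 makes the denominator positive. *)
pose t := r / 2 / (`|u| + `|v| + 1).
have t0 : 0 < t by rewrite !divr_gt0.
have inball a b : 0 <= a <= t -> 0 <= b <= t -> ball x r (x + a *: u + b *: v).
  move=> /andP[a0 at_] /andP[b0 bt].
  rewrite -ball_normE/= -addrA opprD addrA subrr sub0r normrN.
  apply: le_lt_trans (ler_normD _ _) _; rewrite !normrZ !ger0_norm//.
  apply: (@le_lt_trans _ _ (t * (`|u| + `|v| + 1))).
    rewrite !mulrDr mulr1; apply: ler_wpDr; first exact: ltW.
    by apply: lerD; rewrite ler_wpM2r.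
  by rewrite divfK ?gt_eqF// ltr_pdivrMr// ltr_pMr// ltr1n.
have [a [b [at_ bt E1]]] := second_difference oA t0 (sf 2%N)
  (fun a b aP bP => proj1 (proj1 (xr _ (inball a b aP bP)))).
have inball' a' b' : 0 <= a' <= t -> 0 <= b' <= t -> A (x + a' *: v + b' *: u).
  by move=> aP bP; rewrite addrAC; exact: (xr _ (inball _ _ bP aP)).1.1.
have [b' [a' [bt' at' E2]]] := second_difference oA t0 (sf 2%N) inball'.
have E : 'D_v ('D_u f) (x + a *: u + b *: v) = 'D_u ('D_v f) (x + a' *: u + b' *: v).
  apply: (@mulfI _ (t ^+ 2)); first by rewrite expf_neq0 ?gt_eqF.
  rewrite (addrAC x (a' *: u) (b' *: v)).
  apply: etrans (esym E1) (etrans _ E2); rewrite (addrAC x (t *: v) (t *: u)).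
  move: (f _) (f _) (f _) (f _) => p1 p2 p3 p4; ring.
have [_ /= H1] := xr _ (inball _ _ at_ bt).
have [[_ /= H2] _] := xr _ (inball _ _ at' bt').
rewrite -E in H2; set m := 'D_v ('D_u f) (_ + _) in H1 H2.
apply: le_trans (ler_distD m _ _) _.
apply: (@le_trans _ _ (e / 2 + e / 2)); last by rewrite -splitr.
by apply: lerD; [exact: (ltW H2)|rewrite distrC; exact: (ltW H1)].
Qed.

End Schwarz.

(** * Charts and vector fields *)

Section Charts.
Context {R : realType} {M : manifold R}.
Local Notation T := 'rV[R]_(mdim M).
Local Notation mc := (@mchart R M).
Implicit Types (c : chart R M (mdim M)) (k m n : M).

Lemma cinv_img c z : (cmap c @` cdom c) z -> cdom c (cinv c z).
Proof. by move=> [k ck <-]; rewrite cmapK. Qed.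

Lemma cinvK c z : (cmap c @` cdom c) z -> cmap c (cinv c z) = z.
Proof. by move=> [k ck <-]; rewrite cmapK. Qed.

Lemma cinv_cvg c k : cdom c k -> cinv c z @[z --> cmap c k] --> k.
Proof.
move=> ck; have := @cinv_cont _ _ _ c.
rewrite continuous_open_subspace; last exact: cimg_open.
move/(_ (cmap c k)); rewrite inE => /(_ _).
by rewrite /continuous_at cmapK //; apply; exists k.
Qed.

Lemma cmap_cvg c k : cdom c k -> cmap c z @[z --> k] --> cmap c k.
Proof.
move=> ck; have := @cmap_cont _ _ _ c.
rewrite continuous_open_subspace; last exact: cdom_open.
by move/(_ k); rewrite inE; exact.
Qed.

Lemma nbhs_img c k (O : set M) : nbhs k O -> cdom c k ->
  nbhs (cmap c k) (cmap c @` (O `&` cdom c)).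
Proof.
move=> kO ck.
have nO : nbhs (cmap c k) (cinv c @^-1` O) by exact: cinv_cvg ck _ kO.
have nI : nbhs (cmap c k) (cmap c @` cdom c).
  by apply: open_nbhs_nbhs; split; [exact: cimg_open|exists k].
apply: filterS2 nO nI => z Oz Iz; exists (cinv c z); last exact: cinvK.
by split=> //; exact: cinv_img.
Qed.

Lemma open_img c (O : set M) : open O -> open (cmap c @` (O `&` cdom c)).
Proof.
move=> oO; rewrite openE => _ [k [Ok ck] <-]; apply: nbhs_img => //.
exact: open_nbhs_nbhs.
Qed.

Definition tr m n : T -> T := cmap (mc n) \o cinv (mc m).
Definition tr_dom m n : set T := cmap (mc m) @` (cdom (mc m) `&` cdom (mc n)).

Lemma tr_dom_open m n : open (tr_dom m n).
Proof. by rewrite /tr_dom setIC; apply: open_img; exact: cdom_open. Qed.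

Lemma tr_smooth m n : smooth_on (tr_dom m n) (tr m n).
Proof. exact: mchart_smooth. Qed.

Lemma tr_domP m n k : cdom (mc m) k -> cdom (mc n) k -> tr_dom m n (cmap (mc m) k).
Proof. by move=> mk nk; exists k. Qed.

Lemma tr_cmap m n k : cdom (mc m) k -> tr m n (cmap (mc m) k) = cmap (mc n) k.
Proof. by move=> mk; rewrite /tr/= cmapK. Qed.

Lemma tr_differentiable m n k : cdom (mc m) k -> cdom (mc n) k ->
  differentiable (tr m n) (cmap (mc m) k).
Proof.
by move=> mk nk; exact: smooth_differentiable (@tr_smooth m n) (tr_domP mk nk).
Qed.

Lemma near_cinv m k (O : set M) : nbhs k O -> cdom (mc m) k ->
  \forall z \near cmap (mc m) k, [/\ O (cinv (mc m) z), cdom (mc m) (cinv (mc m) z)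
    & cmap (mc m) (cinv (mc m) z) = z].
Proof.
move=> kO mk; apply: filterS (nbhs_img kO mk) => _ [y [Oy my] <-].
by rewrite !cmapK.
Qed.

Lemma tchange_id m k v : cdom (mc m) k -> tchange (mc m) (mc m) k v = v.
Proof.
move=> mk; rewrite /tchange -[RHS](derive_id (cmap (mc m) k)).
apply: near_eq_derive; have kO := open_nbhs_nbhs (conj (cdom_open (mc m)) mk).
by apply: filterS (near_cinv kO mk) => z [_ _].
Qed.

Lemma tchange_comp a b d k v :
  cdom (mc a) k -> cdom (mc b) k -> cdom (mc d) k ->
  tchange (mc b) (mc d) k (tchange (mc a) (mc b) k v) = tchange (mc a) (mc d) k v.
Proof.
move=> ak bk ck; rewrite /tchange -/(tr b d) -/(tr a b) -/(tr a d).
rewrite -[in LHS](tr_cmap b ak) -derive_chain; last 2 first.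
- exact: tr_differentiable.
- by rewrite tr_cmap//; exact: tr_differentiable.
apply: near_eq_derive; have kO := open_nbhs_nbhs (conj (cdom_open (mc b)) bk).
by apply: filterS (near_cinv kO ak) => z [bz az zE]; rewrite /tr/= cmapK.
Qed.

Lemma tchange_lin m n k a v v' : cdom (mc m) k -> cdom (mc n) k ->
  tchange (mc m) (mc n) k (a *: v + v') =
  a *: tchange (mc m) (mc n) k v + tchange (mc m) (mc n) k v'.
Proof. by move=> mk nk; apply: derive_linear; exact: tr_differentiable. Qed.

Lemma tchange0 c c' k : tchange c c' k 0 = 0.
Proof. exact: derive0. Qed.

Lemma field_in_cmap m X k : cdom (mc m) k ->
  field_in (mc m) X (cmap (mc m) k) = tchange (mc k) (mc m) k (X k).
Proof. by move=> mk; rewrite /field_in cmapK. Qed.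

Lemma field_in_center X k : field_in (mc k) X (cmap (mc k) k) = X k.
Proof.
have kk := mchart_dom k; rewrite field_in_cmap// tchange_id//.
Qed.

Lemma tchange_field_in m n X k : cdom (mc m) k -> cdom (mc n) k ->
  tchange (mc m) (mc n) k (field_in (mc m) X (cmap (mc m) k)) =
  field_in (mc n) X (cmap (mc n) k).
Proof.
move=> mk nk; rewrite (field_in_cmap X mk) (field_in_cmap X nk).
exact: (tchange_comp _ (mchart_dom k) mk nk).
Qed.

Lemma smooth_field_img X m k : smooth_field X -> cdom (mc m) k ->
  differentiable (field_in (mc m) X) (cmap (mc m) k).
Proof. by move=> sX mk; apply: smooth_differentiable (sX m) _; exists k. Qed.

Lemma compact_closed_ball (x : T) r : 0 < r -> compact (closed_ball x r).
Proof.
move=> r0; apply: bounded_closed_compact; last exact: closed_ball_closed.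
rewrite closed_ballE//; exists (`|x| + r); split; first exact: num_real.
move=> s rs y /= xy; apply: le_trans (ltW rs).
rewrite -[y](subrKC x) (le_trans (ler_normD _ _))// lerD2l distrC//.
Qed.

(* Extends by zero a cut-off of the field that is constant in the chart at m. *)
Lemma exists_field_const m v : exists2 X, smooth_field X &
  \forall k \near m, cdom (mc m) k /\ field_in (mc m) X (cmap (mc m) k) = v.
Proof.
pose c := mc m; have cm : cdom c m := mchart_dom m.
have /nbhs_closedballP[e] : nbhs (cmap c m) (cmap c @` cdom c).
  by apply: open_nbhs_nbhs; split; [exact: cimg_open|exists m].
have : 0 < e%:num by []; move: e%:num => r r0 rI.
pose B := closed_ball (cmap c m) r; pose K := cinv c @` B.
(* A compact set is closed because M is Hausdorff; the complement of K is then open, and there the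
   field extended by zero is smooth. *)
have clK : closed K.
  apply: compact_closed (@mhausdorff _ M) _; apply: continuous_compact.
    exact: continuous_subspaceW rI (@cinv_cont _ _ _ c).
  exact: compact_closed_ball.
have KB k : cdom c k -> ~ K k -> ~ B (cmap c k).
  by move=> ck nK Bk; apply: nK; exists (cmap c k) => //; rewrite cmapK.
have Kdom k : K k -> cdom c k by move=> [z /rI zI <-]; exact: cinv_img.
(* The value at k has to be given in the chart of index k, hence the change of chart applied to the
   constant v. *)
pose X k := if `[< cdom c k >] then
  bump_fun (cmap c m) r (cmap c k) *: tchange c (mc k) k v else 0.
have X0 k : ~ K k -> X k = 0.
  move=> nK; rewrite /X; case: asboolP => // ck.
  by rewrite bump_fun_out ?scale0r//; exact: KB.
have XE n k : cdom c k -> cdom (mc n) k -> field_in (mc n) X (cmap (mc n) k) =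
    bump_fun (cmap c m) r (cmap c k) *: tchange c (mc n) k v.
  move=> ck nk; rewrite field_in_cmap// /X asboolT//.
  rewrite -[_ *: _]addr0 tchange_lin ?tchange0 ?addr0 ?tchange_comp//; exact: mchart_dom.
exists X.
  move=> n N; apply: ndiff_local => _ [k nk <-].
  have [Kk|nKk] := pselect (K k).
    have ck := Kdom _ Kk.
    exists (tr_dom n m); split; [exact: tr_dom_open|exact: tr_domP|].
    (* Near a point of K the field is carried to the chart n by the derivative of the transition map
       [tr m n]. *)
    exists (fun z => bump_fun (cmap c m) r (tr n m z) *: 'D_v (tr m n) (tr n m z)).
      have otr := @tr_dom_open n m; have otr' := @tr_dom_open m n.
      apply: ndiffZ => //.
        by apply: (ndiff_compR otr (B := setT) _ _ (ndiff_bump_fun _ _ _ _)) => //;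
          exact: tr_smooth.
      apply: (ndiff_comp_row otr otr' _ (@tr_smooth n m N)
        (smooth_derive v (@tr_smooth m n) N)).
      by move=> _ [y [ny my] <-]; rewrite tr_cmap//; exact: tr_domP.
    by move=> _ [y [ny my] <-]; rewrite (XE n y my ny) (tr_cmap m ny).
  have oK : open (~` K) by exact: closed_openC.
  exists (cmap (mc n) @` (~` K `&` cdom (mc n))); split.
  - exact: open_img.
  - by exists k.
  - exists (fun=> 0); first exact: ndiff0.
    by move=> _ [y [nK ny] <-]; rewrite field_in_cmap// X0// tchange0.
have b1 : \forall k \near m, bump_fun (cmap c m) r (cmap c k) = 1.
  exact: (cmap_cvg cm (bump_fun_near1 _ r0)).
have oc := open_nbhs_nbhs (conj (cdom_open c) cm).
apply: filterS2 oc b1 => k ck bk; split=> //.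
by rewrite XE// bk scale1r tchange_id.
Qed.

Lemma exists_field m v : exists2 X, smooth_field X & X m = v.
Proof.
have [X sX /nbhs_singleton[mm Xv]] := exists_field_const m v.
by exists X => //; rewrite -field_in_center.
Qed.

Lemma schwarz_row (V : normedModType R) d (f : V -> 'rV[R]_d) (A : set V) x u v :
  open A -> A x -> smooth_on A f -> 'D_u ('D_v f) x = 'D_v ('D_u f) x.
Proof.
move=> oA Ax sf; apply/rowP => i.
have sfi : smooth_on A (fun y => f y 0 i) by move=> n; exact: ndiff_coord.
have D w w' : 'D_w ('D_w' f) x 0 i = 'D_w ('D_w' (fun y => f y 0 i)) x.
  rewrite derive_coord; last first.
    by apply/diff_derivable; exact: smooth_differentiable (smooth_derive _ sf) Ax.
  apply: near_eq_derive; apply: filterS (open_nbhs_nbhs (conj oA Ax)) => y Ay.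
  by rewrite derive_coord//; exact/diff_derivable/(smooth_differentiable sf).
exact: etrans (D u v) (etrans (schwarz u v oA Ax sfi) (esym (D v u))).
Qed.

(** The bracket at k is computed in the chart of index k, where a field equal to v' in the chart m
    reads ['D_v' (tr m k)] composed with the inverse transition. Differentiating along the other
    field gives a second derivative of [tr m k], and the bracket is the difference of the two mixed
    ones. *)
Lemma bracket_const m (O : set M) X X' v v' : open O -> O `<=` cdom (mc m) ->
  (forall k, O k -> field_in (mc m) X (cmap (mc m) k) = v) ->
  (forall k, O k -> field_in (mc m) X' (cmap (mc m) k) = v') ->
  forall k, O k -> bracket X X' k = 0.
Proof.
move=> oO Om Xv Xv' k Ok; have mk := Om _ Ok; have kk := mchart_dom k.
pose phi := tr m k; pose psi := tr k m.
have E Z Z' w w' : (forall k, O k -> field_in (mc m) Z (cmap (mc m) k) = w) ->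
    (forall k, O k -> field_in (mc m) Z' (cmap (mc m) k) = w') ->
    'D_(Z k) (field_in (mc k) Z') (cmap (mc k) k) = 'D_w ('D_w' phi) (cmap (mc m) k).
  move=> Zw Zw'.
  rewrite (@near_eq_derive _ _ _ _ ('D_w' phi \o psi)); last first.
    apply: filterS (near_cinv (open_nbhs_nbhs (conj oO Ok)) kk) => z [Oz kz zE].
    have mz := Om _ Oz; rewrite -zE -(tchange_field_in Z' mz kz) (Zw' _ Oz).
    by rewrite /psi/= tr_cmap.
  have psiE : psi (cmap (mc k) k) = cmap (mc m) k := tr_cmap m kk.
  have dpsi : differentiable psi (cmap (mc k) k) := tr_differentiable kk mk.
  have dphi : differentiable ('D_w' phi) (psi (cmap (mc k) k)).
    rewrite psiE; apply: smooth_differentiable (tr_domP mk kk).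
    exact: (smooth_derive w' (@tr_smooth m k)).
  rewrite (derive_chain (Z k) dpsi dphi) psiE; congr ('D__ _ _).
  exact: etrans (esym (field_in_cmap Z mk)) (Zw _ Ok).
rewrite /bracket (E _ _ _ _ Xv Xv') (E _ _ _ _ Xv' Xv).
have S := schwarz_row v v' (@tr_dom_open m k) (tr_domP mk kk) (@tr_smooth m k).
by apply/eqP; rewrite subr_eq0; apply/eqP; exact: S.
Qed.

End Charts.

(** * Bi-forms in charts *)

Section LineDerivative.
Context {R : realType} {V W : normedModType R}.

(** A directional derivative sees only a line. Along (X, 0) the right point does not move, so the
    right fields can be frozen at their values there. *)
Lemma is_derive_line (f g : V -> W) a v df :
  (forall h : R, f (h *: v + a) = g (h *: v + a)) ->
  is_derive a v f df -> is_derive a v g df.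
Proof.
move=> fg [dfa <-].
have E : (fun h : R => h^-1 *: ((f \o shift a) (h *: v) - f a)) =
    (fun h : R => h^-1 *: ((g \o shift a) (h *: v) - g a)).
  apply/funext => h; have := fg 0; rewrite scale0r add0r => ->.
  by rewrite /= fg.
apply: DeriveDef; first by move: dfa; rewrite /derivable E.
by rewrite /derive E.
Qed.

End LineDerivative.

Section Koszul.
Context {R : realType} {M : manifold R}.
Local Notation T := 'rV[R]_(mdim M).
Local Notation mc := (@mchart R M).
Implicit Types (x y : M * M) (z : T * T) (U : set (M * M)).

Lemma chart2K x y : chart2_dom x y -> chart2_inv x (chart2 x y) = y.
Proof. by move=> [y1 y2]; rewrite /chart2_inv /chart2/= !cmapK// -surjective_pairing. Qed.

Lemma chart2_dom_center x : chart2_dom x x.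
Proof. by split; exact: mchart_dom. Qed.

Lemma near_chart2_inv x y U : open U -> U y -> chart2_dom x y ->
  \forall z \near chart2 x y, [/\ U (chart2_inv x z), chart2_dom x (chart2_inv x z)
    & chart2 x (chart2_inv x z) = z].
Proof.
move=> oU Uy xy; have : nbhs (chart2 x y) (chart2 x @` (U `&` chart2_dom x)).
  by apply: open_nbhs_nbhs; split; [exact: chart2_img_open|exists y].
by apply: filterS => _ [y' [Uy' xy'] <-]; rewrite chart2K.
Qed.

Lemma differentiable_fst (A B : normedModType R) (p : A * B) :
  differentiable (@fst A B) p.
Proof. by apply: linear_differentiable => ?; exact: cvg_fst. Qed.

Lemma differentiable_snd (A B : normedModType R) (p : A * B) :
  differentiable (@snd A B) p.
Proof. by apply: linear_differentiable => ?; exact: cvg_snd. Qed.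

Lemma chart2_open_dom x : open (chart2_dom x).
Proof.
rewrite openE => y [y1 y2]; exists (cdom (mc x.1), cdom (mc x.2)) => //.
by split; apply: open_nbhs_nbhs; split => //; exact: cdom_open.
Qed.

Lemma derive_pair_fst (f g : T -> T) (u : T) z :
  differentiable f z.1 -> differentiable g z.2 ->
  differentiable (fun y : T * T => (f y.1, g y.2)) z /\
  'D_(u, 0) (fun y : T * T => (f y.1, g y.2)) z = ('D_u f z.1, 0).
Proof.
move=> df dg.
have df1 : differentiable (f \o fst) z.
  by apply: differentiable_comp; [exact: differentiable_fst|].
have dg2 : differentiable (g \o snd) z.
  by apply: differentiable_comp; [exact: differentiable_snd|].
have dp := differentiable_pair df1 dg2; split=> //.
pose u0 : T * T := (u, 0).
have D1 : 'd (f \o fst) z u0 = 'D_u f z.1 := esym (deriveE u0 df1).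
have D2 : 'd (g \o snd) z u0 = 0 := etrans (esym (deriveE u0 dg2)) (derive0 g z.2).
apply: etrans (deriveE u0 dp) _.
apply: etrans (congr1 (fun h : T * T -> T * T => h u0) (diff_pair df1 dg2)) _.
exact: congr2 D1 D2.
Qed.

(** Passes from the chart centred at y to one chart fixed for all nearby y, as needed for an
    identity on a neighbourhood. *)
Lemma lieL_chart x y X f : chart2_dom x y ->
  differentiable (f \o chart2_inv x) (chart2 x y) ->
  lieL X f y = 'D_((field_in (mc x.1) X (cmap (mc x.1) y.1), 0) : T * T)
    (f \o chart2_inv x) (chart2 x y).
Proof.
move=> xy df; have [y1 y2] := xy; have yy := chart2_dom_center y.
pose Psi (z : T * T) := (tr y.1 x.1 z.1, tr y.2 x.2 z.2).
have PsiE : Psi (chart2 y y) = chart2 x y.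
  by rewrite /Psi /chart2/= !tr_cmap//; exact: mchart_dom.
have [dPsi DPsi] := @derive_pair_fst (tr y.1 x.1) (tr y.2 x.2) (X y.1) (chart2 y y)
  (tr_differentiable (mchart_dom _) y1) (tr_differentiable (mchart_dom _) y2).
have E : \forall z \near chart2 y y,
    ((f \o chart2_inv x) \o Psi) z = (f \o chart2_inv y) z.
  have N := near_chart2_inv (@chart2_open_dom x) xy yy.
  apply: filterS N => z [xz yz zE].
  rewrite /= -[in RHS](chart2K xz); congr (f (chart2_inv x _)).
have df' : differentiable (f \o chart2_inv x) (Psi (chart2 y y)) by rewrite PsiE.
apply: etrans (esym (near_eq_derive (X y.1, 0 : T) E)) _.
apply: etrans (derive_chain (X y.1, 0 : T) dPsi df') _.
apply: etrans (congr1 (fun z => 'D_('D_((X y.1, 0) : T * T) Psi (chart2 y y))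
  (f \o chart2_inv x) z) PsiE) _.
apply: (congr1 (fun w : T * T => 'D_w (f \o chart2_inv x) (chart2 x y))).
apply: etrans DPsi _; congr pair.
by rewrite (field_in_cmap _ y1).
Qed.

Lemma eval_component p q (w : rawbiform M p q) X Y x y : chart2_dom x y ->
  eval_fields w X Y y =
  component w x (fun i => field_in (mc x.1) (X i) (cmap (mc x.1) y.1))
    (fun j => field_in (mc x.2) (Y j) (cmap (mc x.2) y.2)) (chart2 x y).
Proof.
move=> xy; have [y1 y2] := xy; rewrite /component (chart2K xy) /eval_fields /=.
congr (w y _ _); apply/funext => i.
  rewrite -[LHS]field_in_center.
  exact: esym (tchange_field_in (X i) y1 (mchart_dom _)).
rewrite -[LHS]field_in_center.
exact: esym (tchange_field_in (Y i) y2 (mchart_dom _)).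
Qed.

Lemma eval_component_inv p q (w : rawbiform M p q) X Y x z :
  chart2_dom x (chart2_inv x z) -> chart2 x (chart2_inv x z) = z ->
  eval_fields w X Y (chart2_inv x z) =
  component w x (fun i => field_in (mc x.1) (X i) z.1)
    (fun j => field_in (mc x.2) (Y j) z.2) z.
Proof.
move=> xz zE; apply: etrans (eval_component w X Y xz) _.
have E1 : cmap (mc x.1) (chart2_inv x z).1 = z.1 := congr1 fst zE.
have E2 : cmap (mc x.2) (chart2_inv x z).2 = z.2 := congr1 snd zE.
by rewrite zE E1 E2.
Qed.

Lemma component_center p q (w : rawbiform M p q) x v v' :
  component w x v v' (chart2 x x) = w x v v'.
Proof.
rewrite /component (chart2K (chart2_dom_center x)) /=; congr (w x _ _).
  by apply/funext => i; exact: tchange_id (mchart_dom _).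
by apply/funext => i; exact: tchange_id (mchart_dom _).
Qed.

Lemma component_multilinear p q U (w : rawbiform M p q) x y v' :
  biform_on U w -> U y -> chart2_dom x y ->
  multilinear (fun v => component w x v v' (chart2 x y)).
Proof.
move=> [al _ _] Uy xy v i a u u'; have [y1 y2] := xy.
rewrite /component (chart2K xy) /=.
set t := tchange _ _ _; set t' := tchange _ _ _.
have tupd s : (fun j => t (upd v i s j)) = upd (t \o v) i (t s).
  by apply/funext => j; rewrite /upd/=; case: eqP.
have tE : t (a *: u + u') = a *: t u + t u' := tchange_lin _ _ _ y1 (mchart_dom _).
have := proj1 (al y (fun j => t' (v' j)) Uy) (t \o v) i a (t u) (t u').
by rewrite -tE -(tupd (a *: u + u')) -(tupd u) -(tupd u').
Qed.

Lemma component_smooth p q U (w : rawbiform M p q) x v v' : biform_on U w ->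
  smooth_on (chart2 x @` (U `&` chart2_dom x)) (component w x v v').
Proof. by case. Qed.

Lemma component_differentiable p q U (w : rawbiform M p q) x y v v' :
  biform_on U w -> U y -> chart2_dom x y ->
  differentiable (component w x v v') (chart2 x y).
Proof.
move=> Uw Uy xy; apply: smooth_differentiable (component_smooth _ _ _ Uw) _.
by exists y.
Qed.

Lemma is_derive_eval p q U (w : rawbiform M p q) x (D : M -> T) X Y :
  open U -> biform_on U w -> U x -> (forall i, smooth_field (X i)) ->
  is_derive (chart2 x x) ((D x.1, 0) : T * T) (eval_fields w X Y \o chart2_inv x)
    ('D_((D x.1, 0) : T * T)
      (component w x (fun k => X k x.1) (fun j => Y j x.2)) (chart2 x x) +
     \sum_k w x (upd (fun k => X k x.1) k
       ('D_(D x.1) (field_in (mc x.1) (X k)) (cmap (mc x.1) x.1)))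
       (fun j => Y j x.2)).
Proof.
move=> oU Uw Ux sX; have xx := chart2_dom_center x.
pose eta j := Y j x.2.
pose F z v := component w x v eta z.
pose xi k (z : T * T) := field_in (mc x.1) (X k) z.1.
have Flin : \forall z \near chart2 x x, multilinear (F z).
  apply: filterS (near_chart2_inv oU Ux xx) => z [Uz xz zE].
  by rewrite /F -zE; exact: component_multilinear Uw Uz xz.
have Fder v : derivable (fun z => F z v) (chart2 x x) ((D x.1, 0) : T * T).
  exact/diff_derivable/(component_differentiable _ _ Uw Ux xx).
have dxi k : derivable (field_in (mc x.1) (X k)) (cmap (mc x.1) x.1) (D x.1).
  exact/diff_derivable/(smooth_field_img (sX k) (mchart_dom _)).
(* [xi k] depends on the first coordinate only, so its difference quotients along (D, 0) are those
   of the field itself. *)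
have xider k : derivable (xi k) (chart2 x x) ((D x.1, 0) : T * T) by exact: dxi.
have dF := is_derive_multilinear Flin Fder xider.
have xi0 : (fun k => xi k (chart2 x x)) = (fun k => X k x.1).
  by apply/funext => k; exact: field_in_center.
rewrite xi0 in dF.
have dG : is_derive (chart2 x x) ((D x.1, 0) : T * T)
  (fun z => component w x (fun k => xi k z)
              (fun j => field_in (mc x.2) (Y j) z.2) z)
  ('D_((D x.1, 0) : T * T) (fun z => F z (fun k => X k x.1)) (chart2 x x) +
    \sum_k F (chart2 x x) (upd (fun k => X k x.1) k
      ('D_((D x.1, 0) : T * T) (xi k) (chart2 x x)))).
  apply: is_derive_line dF => h; congr (component w x _ _ _).
  apply/funext => j; rewrite /eta -[LHS]field_in_center; congr field_in.
  by rewrite [RHS]/= scaler0 add0r.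
apply: (is_derive_eq (near_eq_is_derive _ dG)).
  apply: filterS (near_chart2_inv oU Ux xx) => z [Uz xz zE].
  exact: esym (eval_component_inv w X Y xz zE).
congr (_ + _); apply: eq_bigr => k _.
have E : 'D_((D x.1, 0) : T * T) (xi k) (chart2 x x) =
    'D_(D x.1) (field_in (mc x.1) (X k)) (cmap (mc x.1) x.1) by [].
rewrite E /F; exact: component_center.
Qed.

End Koszul.

(** * The Koszul formula *)

Section Differential.
Context {R : realType} {M : manifold R}.
Local Notation T := 'rV[R]_(mdim M).
Local Notation mc := (@mchart R M).
Implicit Types (x y : M * M) (z : T * T) (U : set (M * M)).

Lemma openX (A B : topologicalType) (O : set A) (O' : set B) :
  open O -> open O' -> open (O `*` O').
Proof.
move=> oO oO'; rewrite openE => y [y1 y2]; exists (O, O') => //.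
by split; apply: open_nbhs_nbhs.
Qed.

Lemma near_open (A : topologicalType) (a : A) (P : set A) : nbhs a P ->
  exists2 O, open O /\ O a & O `<=` P.
Proof.
by move=> N; exists P^°; [split; [exact: open_interior|]|exact: interior_subset].
Qed.

Lemma multilinear_zero n (f : ('I_n -> T) -> R) v i :
  multilinear f -> v i = 0 -> f v = 0.
Proof.
move=> fl vi; rewrite -(upd_id v i) vi.
by have := fl v i (-1) 0 0; rewrite scaler0 addr0 mulN1r addNr.
Qed.

Lemma biform_on_multilinear p q U (w : rawbiform M p q) x v' :
  biform_on U w -> U x -> multilinear (fun v => w x v v').
Proof. by move=> [al _ _] Ux; exact: (proj1 (al x v' Ux)). Qed.

Section Cartan.
Variables (p q : nat) (U : set (M * M)) (w : rawbiform M p q).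
Hypotheses (oU : open U) (Uw : biform_on U w).

Lemma cartan x X Y : U x -> (forall i, smooth_field (X i)) ->
  koszul w X Y x = \sum_(i < p.+1) (-1) ^+ i *
    'D_((X i x.1, 0) : T * T)
      (component w x (fun k => X (lift i k) x.1) (fun j => Y j x.2)) (chart2 x x).
Proof.
move=> Ux sX; pose eta j := Y j x.2.
pose m i j := 'D_(X i x.1) (field_in (mc x.1) (X j)) (cmap (mc x.1) x.1).
have E i : lieL (X i) (eval_fields w (fun k => X (lift i k)) Y) x =
    'D_((X i x.1, 0) : T * T)
      (component w x (fun k => X (lift i k) x.1) eta) (chart2 x x) +
    \sum_k w x (upd (fun k => X (lift i k) x.1) k (m i (lift i k))) eta.
  have [_ D] := is_derive_eval (X i) Y oU Uw Ux (fun k => sX (lift i k)).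
  exact: D.
have B a b : eval_fields w (fun k => if k == 0%N :> nat then bracket (X a) (X b)
        else X (inord (bump b (bump a k.-1)))) Y x =
    w x (fun k => if k == 0%N :> nat then m a b - m b a
        else X (inord (bump b (bump a k.-1))) x.1) eta.
  by congr (w x _ _); apply/funext => k; case: ifP.
have [al _ _] := Uw.
have C := koszul_cancel (fun i => X i x.1) m (al x eta Ux).
rewrite /koszul.
rewrite (eq_bigr _ (fun (i : 'I_p.+1) _ => congr1 (fun s => (-1) ^+ i * s) (E i))).
under eq_bigr do rewrite mulrDr.
rewrite big_split/= -addrA -[RHS]addr0; congr (_ + _).
rewrite -[RHS]C; congr (_ + _); apply: eq_bigr => a _; apply: eq_bigr => b _.
by rewrite B.
Qed.

End Cartan.

Lemma eval_const p q (w : rawbiform M p q) x y U (V : 'I_p -> M -> T)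
    (W : 'I_q -> M -> T) (v : 'I_p -> T) (v' : 'I_q -> T) :
  open U -> U y -> chart2_dom x y ->
  (forall i y, U y -> field_in (mc x.1) (V i) (cmap (mc x.1) y.1) = v i) ->
  (forall j y, U y -> field_in (mc x.2) (W j) (cmap (mc x.2) y.2) = v' j) ->
  \forall z \near chart2 x y,
    (eval_fields w V W \o chart2_inv x) z = component w x v v' z.
Proof.
move=> oU Uy xy Vv Wv; have N := near_chart2_inv oU Uy xy.
apply: filterS N => z [Uz xz zE] /=; apply: etrans (eval_component _ _ _ xz) _.
rewrite zE; congr (component w x _ _ z); apply/funext => i; first exact: Vv.
exact: Wv.
Qed.

Lemma lieL_const p q (w : rawbiform M p q) x y U (V : 'I_p -> M -> T)
    (W : 'I_q -> M -> T) (v : 'I_p -> T) (v' : 'I_q -> T) Z s :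
  open U -> U y -> chart2_dom x y -> biform_on U w ->
  (forall i y, U y -> field_in (mc x.1) (V i) (cmap (mc x.1) y.1) = v i) ->
  (forall j y, U y -> field_in (mc x.2) (W j) (cmap (mc x.2) y.2) = v' j) ->
  field_in (mc x.1) Z (cmap (mc x.1) y.1) = s ->
  lieL Z (eval_fields w V W) y =
  'D_((s, 0) : T * T) (component w x v v') (chart2 x y).
Proof.
move=> oU Uy xy Uw Vv Wv Zs; have N := eval_const w oU Uy xy Vv Wv.
have d : differentiable (eval_fields w V W \o chart2_inv x) (chart2 x y).
  apply: near_differentiable (component_differentiable v v' Uw Uy xy).
  by apply: filterS N => z ->.
by apply: etrans (lieL_chart Z xy d) _; rewrite Zs; exact: (near_eq_derive _ N).
Qed.

Lemma eval_bracket0 p q (w : rawbiform M p q) (V : 'I_p.+1 -> M -> T) W y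
    (i j : 'I_p.+1) :
  multilinear (fun v => w y v (fun j => W j y.2)) -> (i < j)%N ->
  bracket (V i) (V j) y.1 = 0 ->
  eval_fields w (fun k => if k == 0%N :> nat then bracket (V i) (V j)
                 else V (inord (bump j (bump i k.-1)))) W y = 0.
Proof.
case: p w V i j => [|p] w V i j wl; first by rewrite !ord1.
by move=> _ B0; exact: (@multilinear_zero _ _ _ ord0 wl).
Qed.

(* In the chart at x the differential has the same expression as for constant
   vector fields, whose brackets vanish. *)
Lemma koszul_component p q U (a : rawbiform M p q) (b : rawbiform M p.+1 q) x v v' :
  open U -> biform_on U a ->
  (forall X Y, (forall i, smooth_field (X i)) -> (forall j, smooth_field (Y j)) ->
     forall y, U y -> eval_fields b X Y y = koszul a X Y y) ->
  U x ->
  \forall z \near chart2 x x, component b x v v' z =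
    \sum_(i < p.+1) (-1) ^+ i * 'D_((v i, 0) : T * T)
       (component a x (fun k => v (lift i k)) v') z.
Proof.
move=> oU Ua ab Ux.
pose V i := sval (cid2 (exists_field_const x.1 (v i))).
pose W j := sval (cid2 (exists_field_const x.2 (v' j))).
have sV i : smooth_field (V i) by exact: (s2valP (cid2 _)).
have sW j : smooth_field (W j) by exact: (s2valP (cid2 _)).
have [ O1 [oO1 O1x] VO] : exists2 O, open O /\ O x.1 & forall k, O k ->
    cdom (mc x.1) k /\ forall i, field_in (mc x.1) (V i) (cmap (mc x.1) k) = v i.
  have : \forall k \near x.1, forall i,
      cdom (mc x.1) k /\ field_in (mc x.1) (V i) (cmap (mc x.1) k) = v i.
    by apply: filter_forall => i; exact: (s2valP' (cid2 (exists_field_const x.1 (v i)))).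
  move=> /near_open[ O Ox OV]; exists O => // k /OV Vk.
  (* The indices range over ['I_p.+1], so index 0 exists and yields membership in the chart
     domain. *)
  by split=> [|i]; [exact: (Vk ord0).1|exact: (Vk i).2].
have [ O2 [oO2 O2x] WO] : exists2 O, open O /\ O x.2 & forall k, O k ->
    forall j, field_in (mc x.2) (W j) (cmap (mc x.2) k) = v' j.
  have : \forall k \near x.2, forall j,
      field_in (mc x.2) (W j) (cmap (mc x.2) k) = v' j.
    apply: filter_forall => j.
    by apply: filterS (s2valP' (cid2 (exists_field_const x.2 (v' j)))) => k [].
  by move=> /near_open[ O Ox OW]; exists O => // k /OW.
(* On O the fields V and W are constant in the charts of index x.1 and x.2, and the brackets of the
   V vanish. *)
pose O := U `&` O1 `*` O2.
have oO : open O by apply: openI => //; exact: openX.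
have Oa : biform_on O a by apply: biform_on_sub Ua => y [].
have Ox : O x by split.
have VO' i y : O y -> field_in (mc x.1) (V i) (cmap (mc x.1) y.1) = v i.
  by move=> [_ [/VO[_ Vi] _]]; exact: Vi.
have WO' j y : O y -> field_in (mc x.2) (W j) (cmap (mc x.2) y.2) = v' j.
  by move=> [_ [_ /WO]]; exact.
have N := near_chart2_inv oO Ox (chart2_dom_center x).
have E := eval_const b oO Ox (chart2_dom_center x) VO' WO'.
apply: filterS2 N E => z [Oz xz zE] <- /=.
move: (chart2_inv x z) Oz xz zE => y Oy xy <-.
have Uy : U y by case: Oy.
rewrite (ab _ _ sV sW _ Uy) /koszul; set S := (X in _ + X).
have -> : S = 0.
  rewrite /S big1// => i _; rewrite big1// => j ij.
  have B0 : bracket (V i) (V j) y.1 = 0.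
    apply: (bracket_const oO1 _ (fun k Ok => (VO k Ok).2 i) (fun k Ok => (VO k Ok).2 j)).
      by move=> k /VO[].
    by case: Oy => _ [].
  by rewrite (eval_bracket0 (biform_on_multilinear _ Ua Uy) ij B0) mulr0.
rewrite addr0; apply: eq_bigr => i _; congr (_ * _).
exact: lieL_const oO Oy xy Oa (fun k => VO' (lift i k)) WO' (VO' i y Oy).
Qed.

End Differential.

Section Differential2.
Context {R : realType} {M : manifold R}.
Local Notation T := 'rV[R]_(mdim M).
Implicit Types (x y : M * M) (z : T * T) (U : set (M * M)).

Lemma koszul_near p q (w w' : rawbiform M p q) X Y U x : open U ->
  (forall y, U y -> w y = w' y) -> U x -> koszul w X Y x = koszul w' X Y x.
Proof.
move=> oU ww' Ux.
have E X' Y' y : U y -> eval_fields w X' Y' y = eval_fields w' X' Y' y.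
  by move=> Uy; rewrite /eval_fields ww'.
rewrite /koszul; congr (_ + _).
  apply: eq_bigr => i _; congr (_ * _); apply: near_eq_derive.
  have N := near_chart2_inv oU Ux (chart2_dom_center x).
  by apply: filterS N => z [Uz _ _]; exact: E.
by apply: eq_bigr => i _; apply: eq_bigr => j _; rewrite E.
Qed.

(** Through [cartan] the claim reduces to linearity of derivatives of components, which are
    differentiable. *)
Lemma koszul_lin p q (w w' : rawbiform M p q) U c X Y x :
  open U -> biform_on U w -> biform_on U w' -> U x ->
  (forall i, smooth_field (X i)) ->
  koszul (c *: w + w') X Y x = c * koszul w X Y x + koszul w' X Y x.
Proof.
move=> oU Uw Uw' Ux sX; have Uw'' := biform_on_lin c oU Uw Uw'.
rewrite (cartan oU Uw'' _ Ux sX) (cartan oU Uw _ Ux sX) (cartan oU Uw' _ Ux sX).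
rewrite mulr_sumr -big_split; apply: eq_bigr => i _ /=.
rewrite [c * _]mulrCA -mulrDr; congr (_ * _).
set v := fun k => X (lift i k) x.1; set v' := fun j => Y j x.2.
have xx := chart2_dom_center x.
have d := diff_derivable (v := (X i x.1, 0) : T * T)
  (component_differentiable v v' Uw Ux xx).
have d' := diff_derivable (v := (X i x.1, 0) : T * T)
  (component_differentiable v v' Uw' Ux xx).
have dc := derivableZ (k := c) d.
apply: etrans (deriveD dc d') _; congr (_ + _); exact: deriveZ.
Qed.

Lemma is_dL_near p q (w w' : rawbiform M p q) (e e' : rawbiform M p.+1 q) U :
  @nbhd_diag R M U -> (forall y, U y -> w y = w' y) ->
  (forall y, U y -> e y = e' y) -> is_dL w e -> is_dL w' e'.
Proof.
move=> dU ww' ee' [U' dU' we]; exists (U `&` U'); first exact: nbhd_diagI.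
move=> X Y sX sY x [Ux U'x]; rewrite -(koszul_near X Y dU.1 ww' Ux) -we//.
by rewrite /eval_fields ee'.
Qed.

Lemma is_dL_lin p q (w w' : rawbiform M p q) (e e' : rawbiform M p.+1 q) c :
  local_biform w -> local_biform w' -> is_dL w e -> is_dL w' e' ->
  is_dL (c *: w + w') (c *: e + e').
Proof.
move=> [U dU Uw] [U' dU' Uw'] [ O dO we] [ O' dO' we'].
exists ((U `&` U') `&` (O `&` O')); first by do 2?apply: nbhd_diagI.
move=> X Y sX sY x [[Ux U'x] [Ox O'x]].
have dUU := nbhd_diagI dU dU'.
have bw : biform_on (U `&` U') w by apply: biform_on_sub Uw => y [].
have bw' : biform_on (U `&` U') w' by apply: biform_on_sub Uw' => y [].
rewrite (koszul_lin c Y dUU.1 bw bw' (conj Ux U'x) sX) -we// -we'//.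
Qed.

Lemma is_dL_unique p q (w : rawbiform M p q) (e e' : rawbiform M p.+1 q) :
  is_dL w e -> is_dL w e' ->
  exists2 U, @nbhd_diag R M U & forall y, U y -> e y = e' y.
Proof.
move=> [U dU we] [U' dU' we']; exists (U `&` U'); first exact: nbhd_diagI.
move=> x [Ux U'x]; apply/funext => v; apply/funext => v'.
pose V i := sval (cid2 (exists_field x.1 (v i))).
pose W j := sval (cid2 (exists_field x.2 (v' j))).
have sV i : smooth_field (V i) by exact: (s2valP (cid2 _)).
have sW j : smooth_field (W j) by exact: (s2valP (cid2 _)).
have VE : (fun i => V i x.1) = v.
  by apply/funext => i; exact: (s2valP' (cid2 (exists_field x.1 (v i)))).
have WE : (fun j => W j x.2) = v'.
  by apply/funext => j; exact: (s2valP' (cid2 (exists_field x.2 (v' j)))).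
by have := we _ _ sV sW x Ux; rewrite -we'// /eval_fields VE WE.
Qed.

(** The outer differential is only evaluated at x, where [cartan] applies; the components of b are
    differentiated, so they must be known near x, which [koszul_component] provides. *)
Lemma is_dL_dL p q (a : rawbiform M p q) (b : rawbiform M p.+1 q) :
  local_biform a -> local_biform b -> is_dL a b -> is_dL b 0.
Proof.
move=> [Ua da aU] [Ub db bU] [U dU ab].
have dO := nbhd_diagI dU (nbhd_diagI da db).
exists (U `&` (Ua `&` Ub)) => // X Y sX sY x Ox.
have aO : biform_on (U `&` (Ua `&` Ub)) a by apply: biform_on_sub aU => y [_ []].
have bO : biform_on (U `&` (Ua `&` Ub)) b by apply: biform_on_sub bU => y [_ []].
rewrite (cartan dO.1 bO Y Ox sX) [LHS]/eval_fields [LHS]/=.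
pose xi k := X k x.1; pose eta j := Y j x.2.
pose G i j := 'D_((xi i, 0) : T * T) ('D_((xi j, 0) : T * T)
  (component a x (rest xi i j) eta)) (chart2 x x).
have smooth_a v := component_smooth x v eta aO.
have oI := chart2_img_open (x := x) dO.1.
have Ix : (chart2 x @` ((U `&` (Ua `&` Ub)) `&` chart2_dom x)) (chart2 x x).
  by exists x => //; split=> //; exact: chart2_dom_center.
(* Both sides omit the same two arguments, so they are the mixed derivatives of a single
   component. *)
have Gsym i j : G i j = G j i.
  by rewrite /G [rest xi i j]restC; exact: (schwarz _ _ oI Ix (smooth_a _)).
symmetry; rewrite -[RHS](signed_pairs_sym Gsym); apply: eq_bigr => i _.
have N := koszul_component (fun k => xi (lift i k)) eta dO.1 aO
  (fun X Y sX sY y Oy => ab X Y sX sY y Oy.1) Ox.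
rewrite (near_eq_derive _ N).
pose f (k : 'I_p.+1) := 'D_((xi (lift i k), 0) : T * T)
  (component a x (fun l => xi (lift i (lift k l))) eta).
have df k : differentiable (f k) (chart2 x x).
  exact: smooth_differentiable (smooth_derive _ (smooth_a _)) Ix.
have -> : (fun z => \sum_(k < p.+1) (-1) ^+ k * f k z) =
    \sum_(k < p.+1) ((-1) ^+ k \*: f k) by rewrite fct_sumE.
rewrite derive_sum; last first.
  by move=> k; apply: derivableZ; exact/diff_derivable/df.
rewrite mulr_sumr; apply: eq_bigr => k _.
rewrite deriveZ; last exact/diff_derivable/df.
have fG : 'D_((xi i, 0) : T * T) (f k) (chart2 x x) = G i (lift i k).
  by rewrite /f /G -rest_lift.
rewrite fG; move: (G i (lift i k)) => g.
by rewrite exprD -mulrA.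
Qed.

End Differential2.

(** * Germs and homotopy operators *)

Section Germs.
Context {R : realType} {M : manifold R}.
Local Notation T := 'rV[R]_(mdim M).

Lemma local_biform_bfval p q (w : biform M p q) : local_biform w.
Proof. exact/asboolP/(bfvalP w). Qed.

Lemma eq_Omega p q (w w' : biform M p q) U : @nbhd_diag R M U ->
  (forall x, U x -> bfval w x = bfval w' x) ->
  \pi_(Omega M p q) w = \pi_(Omega M p q) w'.
Proof.
move=> dU ww'; apply/eqP; rewrite -Quotient.idealrBE; apply/asboolP.
exists U => // x Ux; have -> : bfval (w - w') x = bfval w x - bfval w' x by [].
by rewrite ww'// subrr.
Qed.

(** [dL] is defined through chosen representatives, which match a given bi-form only near the
    diagonal; this is how statements pass between the two. *)
Lemma repr_pi p q (w : biform M p q) : exists2 U, @nbhd_diag R M U &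
  forall x, U x -> bfval (repr (\pi_(Omega M p q) w)) x = bfval w x.
Proof.
have : repr (\pi_(Omega M p q) w) - w \in @null_biform R M p q.
  by rewrite Quotient.idealrBE reprK.
move=> /asboolP[U dU H]; exists U => // x /H.
have -> : bfval (repr (\pi_(Omega M p q) w) - w) x =
  bfval (repr (\pi_(Omega M p q) w)) x - bfval w x by [].
by move/eqP; rewrite subr_eq0 => /eqP.
Qed.

Lemma repr_lin p q c (w w' : Omega M p q) : exists2 U, @nbhd_diag R M U &
  forall x, U x -> bfval (repr (c *: w + w')) x =
    (c *: (bfval (repr w) : rawbiform M p q) + bfval (repr w')) x.
Proof.
have E : c *: w + w' = \pi_(Omega M p q) (c *: repr w + repr w').
  by rewrite raddfD/= -pi_scale !reprK.
by rewrite E; exact: repr_pi.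
Qed.

Lemma is_dL_repr_unique p q (w : Omega M p q) (e e' : Omega M p.+1 q) :
  is_dL (repr w) (repr e) -> is_dL (repr w) (repr e') -> e = e'.
Proof.
move=> we we'; rewrite -[e]reprK -[e']reprK.
by have [U dU] := is_dL_unique we we'; exact: eq_Omega.
Qed.

Lemma is_dL_repr_lin p q c (w w' : Omega M p q) (e e' : Omega M p.+1 q) :
  is_dL (repr w) (repr e) -> is_dL (repr w') (repr e') ->
  is_dL (repr (c *: w + w')) (repr (c *: e + e')).
Proof.
move=> we we'.
have := is_dL_lin c (local_biform_bfval _) (local_biform_bfval _) we we'.
have [U dU UE] := repr_lin c w w'; have [U' dU' UE'] := repr_lin c e e'.
apply: (is_dL_near (nbhd_diagI dU dU')) => y [Uy U'y]; first by rewrite UE.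
by rewrite UE'.
Qed.

Lemma repr0 p q : exists2 U, @nbhd_diag R M U &
  forall x, U x -> bfval (repr (0 : Omega M p q)) x = 0.
Proof.
have -> : 0 = \pi_(Omega M p q) 0 by rewrite raddf0.
exact: repr_pi.
Qed.

Lemma is_dL_repr0 p q (w : rawbiform M p q) : is_dL w 0 ->
  is_dL w (repr (0 : Omega M p.+1 q)).
Proof.
have [U dU E] := repr0 p.+1 q.
by apply: (is_dL_near dU) => // y Uy; rewrite E.
Qed.

Lemma is_dL00 p q : is_dL (repr (0 : Omega M p q)) (repr (0 : Omega M p.+1 q)).
Proof.
apply: is_dL_repr0; have [U dU E] := repr0 p q.
exists U => // X Y sX sY x Ux.
have b0 := @biform_on0 R M p q U.
rewrite (koszul_near X Y dU.1 E Ux).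
(* Since 0 = -1 *: 0 + 0, linearity makes the Koszul expression of 0 equal to minus itself plus
   itself. *)
have := koszul_lin (-1) Y dU.1 b0 b0 Ux sX.
by rewrite scaler0 addr0 mulN1r addNr => ->.
Qed.

Lemma dL_dL_repr p q (w : Omega M p q) (e : Omega M p.+1 q) :
  is_dL (repr w) (repr e) -> is_dL (repr e) (repr (0 : Omega M p.+2 q)).
Proof.
move=> we; apply: is_dL_repr0.
exact: is_dL_dL (local_biform_bfval _) (local_biform_bfval _) we.
Qed.

Lemma is_dL_one_diag q (w : Omega M 0 q) :
  is_dL (repr (one_diag w)) (repr (0 : Omega M 1 q)).
Proof.
apply: is_dL_repr0; have [U dU E] := repr_pi (BiForm (asboolT
  (local_biform_one_diag (repr w)))).
exists U => // X Y sX sY x Ux.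
rewrite (koszul_near X Y dU.1 E Ux) /koszul.
(* For p = 0 the indices lie in ['I_1], which contains no pair a < b. *)
rewrite [X in _ = _ + X]big1 => [|i _]; last by rewrite big1// => j; rewrite !ord1.
rewrite addr0 big1// => i _; rewrite /lieL.
pose g (s : T) : R := boxtimes (@one_form R M) (rawdiag (repr w))
  (x.1, cinv (mchart x.2) s) (fun=> 0) (fun j => Y j (cinv (mchart x.2) s)).
have -> : 'D_((X i x.1, 0) : T * T) (eval_fields
    (boxtimes (@one_form R M) (rawdiag (repr w)) : rawbiform M 0 q)
    (fun k => X (lift i k)) Y \o chart2_inv x) (chart2 x x) = 0.
  (* The function does not depend on the first component, so its growth rates
     are those of g in the direction 0. *)
  exact: (derive0 g).
by rewrite mulr0.
Qed.

Lemma dLP p q (w : Omega M p q) :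
  (exists e : Omega M p.+1 q, is_dL (repr w) (repr e)) ->
  is_dL (repr w) (repr (dL w)).
Proof. exact: (@xgetPex _ 0 [set e : Omega M p.+1 q | is_dL (repr w) (repr e)]). Qed.

Lemma dL_default p q (w : Omega M p q) :
  ~ (exists e : Omega M p.+1 q, is_dL (repr w) (repr e)) -> dL w = 0.
Proof.
move=> nw; apply: (@xgetPN _ 0 [set e : Omega M p.+1 q | is_dL (repr w) (repr e)]).
by move=> e we; apply: nw; exists e.
Qed.

(* If w had no differential then dL w would be the default value 0, and the
   homotopy formula would make w either exact or equal to 1 [x] w|_diag; in
   both cases 0 is a differential of w. *)
Lemma is_dL_dL_repr (J : left_homotopy_system M) p q (w : Omega M p q) :
  is_dL (repr w) (repr (dL w)).
Proof.
apply: dLP; apply: contrapT => nw; have dw := dL_default nw.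
case: p w nw dw => [|p] w nw dw.
  have := JL_homotopy0 J w; rewrite dw linear0 => /esym/eqP.
  rewrite subr_eq0 => /eqP wE.
  by apply: nw; exists 0; rewrite wE; exact: is_dL_one_diag.
have := JL_homotopy J w; rewrite dw linear0 addr0 => wE.
(* [dL (JL J p q w)] may itself be the default value; then w = 0, and 0 is a differential of it. *)
have [/dLP|nJ] := pselect (exists e : Omega M p.+1 q,
    is_dL (repr (JL J p q w)) (repr e)).
  by rewrite wE => /dL_dL_repr H; apply: nw; exists 0.
by apply: nw; exists 0; rewrite -wE (dL_default nJ); exact: is_dL00.
Qed.

Section Homotopy.
Variable J : left_homotopy_system M.

(** J enters only through the existence of differentials: it guarantees that no value of [dL]
    involved is a mere default. *)
Lemma dL_lin p q c (w w' : Omega M p q) : dL (c *: w + w') = c *: dL w + dL w'.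
Proof.
apply: is_dL_repr_unique (is_dL_dL_repr J _) _.
exact: is_dL_repr_lin (is_dL_dL_repr J w) (is_dL_dL_repr J w').
Qed.

Lemma dL0 p q : dL (0 : Omega M p q) = 0.
Proof. exact: is_dL_repr_unique (is_dL_dL_repr J _) (is_dL00 p q). Qed.

Lemma dL_dL p q (w : Omega M p q) : dL (dL w) = 0.
Proof.
exact: is_dL_repr_unique (is_dL_dL_repr J _) (dL_dL_repr (is_dL_dL_repr J w)).
Qed.

Lemma AL_lin p q c (w w' : Omega M p q) : AL J (c *: w + w') = c *: AL J w + AL J w'.
Proof. by rewrite /AL dL_lin linearP. Qed.

Lemma AL_JL p q (w : Omega M p.+1 q) : AL J (JL J p q w) = JL J p q w.
Proof.
have := congr1 (JL J p q) (JL_homotopy J w).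
by rewrite linearD/= JL_JL addr0.
Qed.

Lemma image_dL_AL p q : @dL R M p q @` range (@AL R M J p q) = range (@EL R M J p.+1 q).
Proof.
apply/seteqP; split=> [_ [_ [w _ <-] <-]|_ [w _ <-]]; first by exists (dL w).
(* J w is its own preimage under A, by J d J = J. *)
by exists (JL J p q w) => //; exists (JL J p q w) => //; exact: AL_JL.
Qed.

Lemma range_AL_subspace p q : is_subspace (range (@AL R M J p q)).
Proof.
split; first by exists 0 => //; rewrite /AL dL0 linear0.
by move=> c _ _ [w _ <-] [w' _ <-]; exists (c *: w + w') => //; exact: AL_lin.
Qed.

Lemma image_dL_subspace p q (A : set (Omega M p q)) :
  is_subspace A -> is_subspace (@dL R M p q @` A).
Proof.
move=> [A0 Al]; split; first by exists 0 => //; exact: dL0.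
move=> c _ _ [w Aw <-] [w' Aw' <-]; exists (c *: w + w'); last exact: dL_lin.
exact: Al.
Qed.

Lemma direct_sum_dL_AL p q :
  is_direct_sum (@dL R M p q @` range (@AL R M J p q)) (range (@AL R M J p.+1 q)).
Proof.
split; [exact/image_dL_subspace/range_AL_subspace|exact: range_AL_subspace| |].
  move=> w; exists (dL (JL J p q w)), (AL J w); split=> //.
  - by exists (JL J p q w) => //; exists (JL J p q w) => //; exact: AL_JL.
  - by rewrite /AL JL_homotopy.
apply/seteqP; split=> [w [[u _ uw] [v _ vw]]|_ ->]; last first.
  split; first by case: (image_dL_subspace (range_AL_subspace p q)).
  by case: (range_AL_subspace p.+1 q).
have := JL_homotopy J w.
rewrite -{1}vw /AL JL_JL dL0 -uw dL_dL linear0 addr0 => <-.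
by [].
Qed.

End Homotopy.
End Germs.

Theorem theorem3p1 (R : realType) (M : manifold R) (J : left_homotopy_system M) :
  (forall p q : nat,
     @dL R M p q @` range (@AL R M J p q) = range (@EL R M J p.+1 q)) /\
  (forall p q : nat,
     is_direct_sum (@dL R M p q @` range (@AL R M J p q))
                   (range (@AL R M J p.+1 q))).
Proof. by split=> p q; [exact: image_dL_AL|exact: direct_sum_dL_AL]. Qed.
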